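(* Let $\mathbb{K}$ be a field and let $\Gamma_1,\Gamma_2\subset\mathbb{N}^{r_1+r_2}$ be affine semigroups minimally generated by the disjoint sets $\mathcal{G}_1=\{\mathbf{a}_1,\dots,\mathbf{a}_{r_1+n_1}\}$ and $\mathcal{G}_2=\{\mathbf{b}_1,\dots,\mathbf{b}_{r_2+n_2}\}$, with sets of extremal rays $\{\mathbf{a}_1,\dots,\mathbf{a}_{r_1}\}$ and $\{\mathbf{b}_1,\dots,\mathbf{b}_{r_2}\}$ respectively, and assume that $\{\mathbf{a}_1,\dots,\mathbf{a}_{r_1},\mathbf{b}_1,\dots,\mathbf{b}_{r_2}\}$ is linearly independent over $\mathbb{Q}$. Let $\Gamma_1\sqcup\Gamma_2$ be the join of $\Gamma_1$ and $\Gamma_2$, and let $I_{\Gamma_1}\subset A_1$, $I_{\Gamma_2}\subset A_2$, $I_{\Gamma_1\sqcup\Gamma_2}\subset A_{12}$ be the defining ideals of $\mathbb{K}[\Gamma_1]$, $\mathbb{K}[\Gamma_2]$, $\mathbb{K}[\Gamma_1\sqcup\Gamma_2]$. Then $$I_{\Gamma_1\sqcup\Gamma_2}=I_{\Gamma_1}A_{12}+I_{\Gamma_2}A_{12}.$$ Moreover, the tensor product over $\mathbb{K}$ of a minimal graded free resolution of $\mathbb{K}[\Gamma_1]$ over $A_1$ and a minimal graded free resolution of $\mathbb{K}[\Gamma_2]$ over $A_2$ is a minimal graded free resolution of $\mathbb{K}[\Gamma_1\sqcup\Gamma_2]$ over $A_{12}$.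
   Context: An affine semigroup is a finitely generated subsemigroup of $\mathbb{N}^m$ containing $0$. An extremal ray of $\Gamma_1$ is the smallest non-zero element of $\Gamma_1$ lying on an extremal ray of the cone $\{\sum\alpha_i\mathbf{a}_i:\alpha_i\in\mathbb{R}_{\ge 0}\}$, and similarly for $\Gamma_2$; thus every element of $\Gamma_1$ (resp. $\Gamma_2$) is a non-negative rational combination of $\mathbf{a}_1,\dots,\mathbf{a}_{r_1}$ (resp. $\mathbf{b}_1,\dots,\mathbf{b}_{r_2}$). The join is the semigroup $\Gamma_1\sqcup\Gamma_2=\langle\mathcal{G}_1\cup\mathcal{G}_2\rangle$. Set $A_1=\mathbb{K}[x_1,\dots,x_{r_1+n_1}]$, $A_2=\mathbb{K}[y_1,\dots,y_{r_2+n_2}]$ (disjoint sets of indeterminates) and $A_{12}=\mathbb{K}[x_1,\dots,x_{r_1+n_1},y_1,\dots,y_{r_2+n_2}]$. For a semigroup $\Gamma$, $\mathbb{K}[\Gamma]$ is the subalgebra of $\mathbb{K}[t_1,\dots,t_{r_1+r_2}]$ spanned by the monomials $\mathbf{t}^\gamma$, $\gamma\in\Gamma$. The defining ideals are the kernels of the $\mathbb{K}$-algebra maps to $\mathbb{K}[t_1,\dots,t_{r_1+r_2}]$ given by $x_i\mapsto\mathbf{t}^{\mathbf{a}_i}$ on $A_1$, by $y_j\mapsto\mathbf{t}^{\mathbf{b}_j}$ on $A_2$, and by both rules on $A_{12}$. Gradings are by $\mathbb{N}^{r_1+r_2}$ with $\deg x_i=\mathbf{a}_i$, $\deg y_j=\mathbf{b}_j$.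 *)

(* Defs.v *)
From mathcomp Require Import all_boot all_order all_algebra.
From mathcomp Require Import reals.
From mathcomp Require Import mpoly.

Set Implicit Arguments.
Unset Strict Implicit.
Unset Printing Implicit Defensive.

Import GRing.Theory Num.Theory.

Local Open Scope ring_scope.

(* Throughout, N^m is the type 'X_{1..m} of exponent vectors, and a finite     *)
(* generating set of a semigroup is listed by a family a : 'I_N -> 'X_{1..m}.  *)

Section Semigroups.
Variables (m N : nat) (a : 'I_N -> 'X_{1..m}).

Definition sgspan_in (J : {set 'I_N}) (g : 'X_{1..m}) : Prop :=
  exists c : 'I_N -> nat, g = (\sum_(i in J) a i *+ c i)%MM.

Definition sgspan (g : 'X_{1..m}) : Prop := sgspan_in [set: 'I_N] g.

(* Indexing by J makes this include that the a i are pairwise distinct and     *)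
(* non-zero.                                                                   *)
Definition minimally_generating : Prop :=
  forall J : {set 'I_N}, (forall g, sgspan g -> sgspan_in J g) -> J = [set: 'I_N].

Definition vec_of (S : nzRingType) (g : 'X_{1..m}) : 'rV[S]_m :=
  \row_k (g k)%:R.

Variable R : realType.

Definition in_cone (v : 'rV[R]_m) : Prop :=
  exists alpha : 'I_N -> R,
    (forall i, 0 <= alpha i) /\ v = \sum_i alpha i *: vec_of R (a i).

Definition in_ray (v w : 'rV[R]_m) : Prop :=
  exists2 l : R, 0 <= l & w = l *: v.

Definition spans_cone_extremal_ray (v : 'rV[R]_m) : Prop :=
  [/\ in_cone v, v != 0 &
      forall x y, in_cone x -> in_cone y -> in_ray v (x + y) ->
        in_ray v x /\ in_ray v y].

(* "Smallest" is for the componentwise order, which is total on a ray.         *)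
Definition extremal_ray_of (g : 'X_{1..m}) : Prop :=
  exists2 v : 'rV[R]_m, spans_cone_extremal_ray v &
    [/\ sgspan g, g <> 0%MM, in_ray v (vec_of R g) &
        forall h, sgspan h -> h <> 0%MM -> in_ray v (vec_of R h) ->
          forall k, (g k <= h k)%N].

End Semigroups.

Section Join.
Variables (m N1 N2 : nat).
Variables (a : 'I_N1 -> 'X_{1..m}) (b : 'I_N2 -> 'X_{1..m}).

Definition join_gens (i : 'I_(N1 + N2)) : 'X_{1..m} :=
  match split i with inl i1 => a i1 | inr i2 => b i2 end.

End Join.

Section Ideals.
Variable K : fieldType.

Definition in_sgring m (G : 'X_{1..m} -> Prop) (f : {mpoly K[m]}) : Prop :=
  forall g, g \in msupp f -> G g.

Definition toric_map m N (a : 'I_N -> 'X_{1..m}) (f : {mpoly K[N]}) :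
    {mpoly K[m]} :=
  f \mPo [tuple 'X_[a i] | i < N].

Definition defining_ideal m N (a : 'I_N -> 'X_{1..m}) (f : {mpoly K[N]}) : Prop :=
  toric_map a f = 0.

Definition incl1 N1 N2 (f : {mpoly K[N1]}) : {mpoly K[N1 + N2]} :=
  f \mPo [tuple 'X_(lshift N2 i) | i < N1].

Definition incl2 N1 N2 (f : {mpoly K[N2]}) : {mpoly K[N1 + N2]} :=
  f \mPo [tuple 'X_(rshift N1 i) | i < N2].

Definition extended_ideal (A B : comNzRingType) (phi : A -> B) (I : A -> Prop)
    (f : B) : Prop :=
  exists (k : nat) (c : 'I_k -> B) (s : 'I_k -> A),
    (forall i, I (s i)) /\ f = \sum_i c i * phi (s i).

Definition ideal_sum (A : comNzRingType) (I J : A -> Prop) (f : A) : Prop :=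
  exists u v, [/\ I u, J v & f = u + v].

End Ideals.

Arguments incl1 {K N1} N2 f.
Arguments incl2 {K} N1 {N2} f.

(* A sequence of finitely generated graded free A-modules, A = K[x_1..x_N],    *)
(* with chosen homogeneous bases, together with A-linear maps                  *)
(*      F_n.+1 -> F_n   and   F_0 -> K[t_1..t_m]                               *)
(* given on the bases. The module F_n is the direct sum over i : gbasis n of   *)
(* the A(- gdeg i); its elements are the finfuns gbasis n -> A.                *)
Record free_complex (K : fieldType) (m N : nat) := FreeComplex {
  gbasis : nat -> finType;
  gdeg : forall n, gbasis n -> 'X_{1..m};
  (* gcoef i j is the coefficient of j in the image of i *)
  gcoef : forall n, gbasis n.+1 -> gbasis n -> {mpoly K[N]};
  gaug : gbasis 0 -> {mpoly K[m]}
}.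
Arguments gdeg [K m N] f [n].
Arguments gcoef [K m N] f [n].
Arguments gaug [K m N] f.

Section Resolutions.
Variables (K : fieldType) (m N : nat) (a : 'I_N -> 'X_{1..m}).
Variable F : free_complex K m N.

Definition gmod (n : nat) := {ffun gbasis F n -> {mpoly K[N]}}.

Definition gdiff n (u : gmod n.+1) : gmod n :=
  [ffun j => \sum_i u i * gcoef F i j].

(* K[t_1..t_m] is an A-module through toric_map a. *)
Definition gaugmentation (u : gmod 0) : {mpoly K[m]} :=
  \sum_i toric_map a (u i) * gaug F i.

(* The N^m-degree of a monomial of A when x_i has degree a i. *)
Definition mondeg (e : 'X_{1..N}) : 'X_{1..m} := (\sum_i a i *+ e i)%MM.

Definition graded_maps : Prop :=
  (forall n (i : gbasis F n.+1) (j : gbasis F n) e,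
     e \in msupp (gcoef F i j) -> (mondeg e + gdeg F j)%MM = gdeg F i) /\
  (forall (i : gbasis F 0) g, g \in msupp (gaug F i) -> g = gdeg F i).

Definition resolves : Prop :=
  [/\ forall i, in_sgring (sgspan a) (gaug F i),
      forall f, in_sgring (sgspan a) f -> exists u, gaugmentation u = f,
      forall u, gaugmentation u = 0 <-> exists v, u = gdiff v &
      forall n (u : gmod n.+1), gdiff u = 0 <-> exists v, u = gdiff v].

(* The image of F_n.+1 lies in (x_1..x_N) F_n. *)
Definition minimal_maps : Prop :=
  forall n (u : gmod n.+1) (j : gbasis F n), (gdiff u j)@_0%MM = 0.

Definition minimal_graded_free_resolution : Prop :=
  [/\ graded_maps, resolves & minimal_maps].

End Resolutions.

(* Since A1 (x)_K A2 = A12, the tensor product over K of free modules with     *)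
(* bases X over A1 and Y over A2 is the free A12-module with basis X * Y, and  *)
(*   (F (x) G)_n = sum_(p + q = n) F_p (x) G_q,                                *)
(*   d (f (x) g) = d f (x) g + (-1) ^ p  f (x) d g      for f in F_p.          *)
Section Tensor.
Variables (K : fieldType) (m N1 N2 : nat).
Variables (F : free_complex K m N1) (G : free_complex K m N2).

Definition tbasis (n : nat) : finType :=
  {p : 'I_n.+1 & (gbasis F p * gbasis G (n - p))%type}.

(* Basis elements of all homological degrees, so that elements of different    *)
(* F_p can be compared.                                                        *)
Definition tfst n (x : tbasis n) : {p : nat & gbasis F p} :=
  Tagged (gbasis F) (tagged x).1.
Definition tsnd n (x : tbasis n) : {q : nat & gbasis G q} :=
  Tagged (gbasis G) (tagged x).2.

(* The coefficient of y in d x; it is 0 unless x has one more than the         *)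
(* homological degree of y.                                                    *)
Definition dcoef N (H : free_complex K m N) (x y : {p : nat & gbasis H p}) :
    {mpoly K[N]} :=
  untag 0 (fun i : gbasis H (tag y).+1 => gcoef H i (tagged y)) x.

Definition daug N (H : free_complex K m N) (x : {p : nat & gbasis H p}) :
    {mpoly K[m]} :=
  untag 0 (gaug H) x.

Definition tdeg n (x : tbasis n) : 'X_{1..m} :=
  (gdeg F (tagged x).1 + gdeg G (tagged x).2)%MM.

Definition tcoef n (x : tbasis n.+1) (y : tbasis n) : {mpoly K[N1 + N2]} :=
  incl1 N2 (dcoef (tfst x) (tfst y)) *+ (tsnd x == tsnd y)
  + (-1) ^+ tag x * incl2 N1 (dcoef (tsnd x) (tsnd y)) *+ (tfst x == tfst y).

Definition taug (x : tbasis 0) : {mpoly K[m]} :=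
  daug (tfst x) * daug (tsnd x).

Definition tensor_complex : free_complex K m (N1 + N2) :=
  @FreeComplex K m (N1 + N2) tbasis tdeg tcoef taug.

End Tensor.

(* Main.v *)
(* Every generator lies in the real span of the extremal rays: an irredundant
   set of generators of the cone consists of vectors on extremal rays, because
   the cone is pointed. Independence of the rays then makes the sum map
   Gamma_1 x Gamma_2 -> N^m injective, so that K[Gamma_1 |_| Gamma_2] is
   K[Gamma_1] (x) K[Gamma_2].

   F (x)_K G is the total complex of a bicomplex of A_12-modules. Collecting
   coefficients of the monomials in x shows that F_p (x) G is a resolution of
   F_p (x) K[Gamma_2]; collecting coefficients of the monomials t^gamma, with
   gamma in Gamma_2, shows that F (x) K[Gamma_2] is a resolution of
   K[Gamma_1] (x) K[Gamma_2]. A cycle of the total complex is therefore a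
   boundary: first its last column is corrected by a lift of an F-boundary over
   K[Gamma_2], then the columns are cleared from right to left. The equality of
   ideals is the same computation with F and G replaced by A_1 and A_2. *)

Require Import Defs.
From HB Require Import structures.
From mathcomp Require Import all_boot all_order all_algebra.
From mathcomp Require Import boolp reals.
From mathcomp Require Import mpoly.
From mathcomp Require Import zify.

Set Implicit Arguments.
Unset Strict Implicit.
Unset Printing Implicit Defensive.

Import Order.TTheory GRing.Theory Num.Theory.

Local Open Scope ring_scope.

(** * Polynomials in x with coefficients in K[y] *)

(** Constants and variables generate the polynomial ring; the compatibilities between substitution
    maps are checked on these. *)
Lemma mpoly_rmorph_ext (R : comNzRingType) (S : nzRingType) n
    (f g : {rmorphism {mpoly R[n]} -> S}) :
  (forall c, f c%:MP = g c%:MP) -> (forall i, f 'X_i = g 'X_i) -> f =1 g.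
Proof.
move=> fC fX p; rewrite [p]mpolyE !raddf_sum; apply: eq_bigr => e _.
rewrite -mul_mpolyC /= !rmorphM fC mpolyXE_id !rmorph_prod; congr (_ * _).
by apply: eq_bigr => i _; rewrite !rmorphXn fX.
Qed.

Section MPolyMorphisms.
Variable K : fieldType.

HB.instance Definition _ m N (a : 'I_N -> 'X_{1..m}) :=
  GRing.RMorphism.copy (@toric_map K m N a)
    (comp_mpoly [tuple 'X_[a i] | i < N]).
HB.instance Definition _ N1 N2 :=
  GRing.RMorphism.copy (@incl1 K N1 N2)
    (comp_mpoly [tuple 'X_(lshift N2 i) | i < N1]).
HB.instance Definition _ N1 N2 :=
  GRing.RMorphism.copy (@incl2 K N1 N2)
    (comp_mpoly [tuple 'X_(rshift N1 i) | i < N2]).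

Lemma toric_mapC m N (a : 'I_N -> 'X_{1..m}) c :
  toric_map a (c%:MP_[N] : {mpoly K[N]}) = c%:MP.
Proof. exact: comp_mpolyC. Qed.

Lemma toric_mapU m N (a : 'I_N -> 'X_{1..m}) i :
  toric_map a ('X_i : {mpoly K[N]}) = 'X_[a i].
Proof. by rewrite /toric_map comp_mpolyXU -tnth_nth tnth_mktuple. Qed.

Lemma toric_mapX m N (a : 'I_N -> 'X_{1..m}) e :
  toric_map a ('X_[e] : {mpoly K[N]}) = 'X_[mondeg a e].
Proof.
rewrite mpolyXE_id rmorph_prod /mondeg.
rewrite (big_morph _ (@mpolyXD m K) (@mpolyX0 m K)).
apply: eq_bigr => i _; rewrite rmorphXn /=.
by rewrite toric_mapU mpolyXn.
Qed.

Variables N1 N2 : nat.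

Lemma incl1C c : incl1 N2 (c%:MP_[N1] : {mpoly K[N1]}) = c%:MP.
Proof. exact: comp_mpolyC. Qed.

Lemma incl2C c : incl2 N1 (c%:MP_[N2] : {mpoly K[N2]}) = c%:MP.
Proof. exact: comp_mpolyC. Qed.

Lemma incl1U i : incl1 N2 ('X_i : {mpoly K[N1]}) = 'X_(lshift N2 i).
Proof. by rewrite /incl1 comp_mpolyXU -tnth_nth tnth_mktuple. Qed.

Lemma incl2U i : incl2 N1 ('X_i : {mpoly K[N2]}) = 'X_(rshift N1 i).
Proof. by rewrite /incl2 comp_mpolyXU -tnth_nth tnth_mktuple. Qed.

Definition poly_in_x : {mpoly K[N1 + N2]} -> {mpoly {mpoly K[N2]}[N1]} :=
  mmap (@mpolyC N1 _ \o @mpolyC N2 K)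
    (fun i => match split i with inl j => 'X_j | inr j => ('X_j)%:MP end).

HB.instance Definition _ := GRing.RMorphism.on poly_in_x.

Lemma poly_in_x_incl1 p : poly_in_x (incl1 N2 p) = map_mpoly (@mpolyC N2 K) p.
Proof.
apply: (mpoly_rmorph_ext (f := poly_in_x \o incl1 N2)
                         (g := map_mpoly (@mpolyC N2 K))) => [c|i] /=.
  by rewrite incl1C /poly_in_x mmapC /= map_mpolyC.
rewrite incl1U /poly_in_x mmapX mmap1U map_mpolyX.
by rewrite -[lshift _ _]/(unsplit (inl _)) unsplitK.
Qed.

Lemma poly_in_x_incl2 p : poly_in_x (incl2 N1 p) = p%:MP.
Proof.
apply: (mpoly_rmorph_ext (f := poly_in_x \o incl2 N1)
                         (g := @mpolyC N1 _)) => [c|i] /=.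
  by rewrite incl2C /poly_in_x mmapC.
rewrite incl2U /poly_in_x mmapX mmap1U.
by rewrite -[rshift _ _]/(unsplit (inr _)) unsplitK.
Qed.

Definition poly_of_x : {mpoly {mpoly K[N2]}[N1]} -> {mpoly K[N1 + N2]} :=
  mmap (incl2 N1) (fun i => 'X_(lshift N2 i)).

HB.instance Definition _ := GRing.RMorphism.on poly_of_x.

Lemma poly_in_xK : cancel poly_in_x poly_of_x.
Proof.
apply: (mpoly_rmorph_ext (f := poly_of_x \o poly_in_x) (g := idfun)) => [c|i] /=.
  by rewrite /poly_in_x mmapC /= /poly_of_x mmapC /= incl2C.
rewrite {1}/poly_in_x mmapX mmap1U /poly_of_x -{2}[i]splitK.
case: (split i) => j /=; first by rewrite mmapX mmap1U.
by rewrite mmapC /= incl2U.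
Qed.

Definition xcoef e (f : {mpoly K[N1 + N2]}) : {mpoly K[N2]} := (poly_in_x f)@_e.

HB.instance Definition _ e := GRing.Additive.copy (xcoef e) (mcoeff e \o poly_in_x).

Lemma xcoefM2 e f h : xcoef e (f * incl2 N1 h) = xcoef e f * h.
Proof.
by rewrite mulrC /xcoef rmorphM /= poly_in_x_incl2 mcoeffCM mulrC.
Qed.

Lemma xcoef_incl e p h : xcoef e (incl1 N2 p * incl2 N1 h) = p@_e *: h.
Proof.
by rewrite xcoefM2 /xcoef poly_in_x_incl1 mcoeff_map_mpoly mul_mpolyC.
Qed.

(** The monomials in x span K[x, y] over K[y]. Any degree bound [b] may be used, so several
    polynomials can be expanded over one finite index type. *)
Lemma xcoef_expand b f : (msize (poly_in_x f) <= b)%N ->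
  f = \sum_(e : 'X_{1..N1 < b}) incl1 N2 'X_[e] * incl2 N1 (xcoef e f).
Proof.
move=> bf; rewrite -[LHS]poly_in_xK [X in poly_of_x X](mpolywE bf) raddf_sum.
apply: eq_bigr => e _ /=; rewrite /poly_of_x mmapZ mmapX mulrC; congr (_ * _).
rewrite mpolyXE_id rmorph_prod; apply: eq_bigr => i _.
by rewrite rmorphXn /= incl1U.
Qed.

End MPolyMorphisms.

(** * Semigroup rings and slices along t-monomials *)

Section SemigroupRing.
Variables (K : fieldType) (m N : nat) (a : 'I_N -> 'X_{1..m}).

Lemma sgspanP g : sgspan a g <-> exists e : 'X_{1..N}, g = mondeg a e.
Proof.
split=> [[c ->]|[e ->]].
  exists [multinom c i | i < N]; rewrite /mondeg.
  by apply: eq_big => [i|i _]; rewrite ?in_setT ?mnmE.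
by exists e; apply: eq_bigl => i; rewrite in_setT.
Qed.

Lemma mondegU j : mondeg a U_(j)%MM = a j.
Proof.
apply/mnmP => k; rewrite mnm_sumE (bigD1 j) //= mulmnE mnm1E eqxx muln1 big1 ?addn0 //.
by move=> i ne_ij; rewrite mulmnE mnm1E eq_sym (negPf ne_ij) muln0.
Qed.

Lemma mondegD e1 e2 : mondeg a (e1 + e2)%MM = (mondeg a e1 + mondeg a e2)%MM.
Proof.
apply/mnmP => k; rewrite mnmDE !mnm_sumE -big_split.
by apply: eq_bigr => i _; rewrite !mulmnE mnmDE mulnDr.
Qed.

Lemma sgspanD g h : sgspan a g -> sgspan a h -> sgspan a (g + h)%MM.
Proof.
move=> /sgspanP[c ->] /sgspanP[d ->]; apply/sgspanP.
by exists (c + d)%MM; rewrite mondegD.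
Qed.

Lemma in_sgring_sum (G : 'X_{1..m} -> Prop) (I : finType) (P : pred I)
    (f : I -> {mpoly K[m]}) :
  (forall i, P i -> in_sgring G (f i)) -> in_sgring G (\sum_(i | P i) f i).
Proof.
move=> Gf; elim/big_rec: _ => [g|i p Pi Gp g]; first by rewrite msupp0.
by move/msuppD_le; rewrite mem_cat => /orP[/(Gf i Pi)|/Gp].
Qed.

Lemma in_sgringM (G : 'X_{1..m} -> Prop) (f1 f2 : {mpoly K[m]}) :
    (forall g h, G g -> G h -> G (g + h)%MM) ->
  in_sgring G f1 -> in_sgring G f2 -> in_sgring G (f1 * f2).
Proof.
move=> GD G1 G2 g /msuppM_le/allpairsP[[g1 g2] /= [s1 s2 ->]].
by apply: GD; [apply: G1|apply: G2].
Qed.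

Lemma toric_map_sgring (p : {mpoly K[N]}) : in_sgring (sgspan a) (toric_map a p).
Proof.
move=> g; rewrite [p]mpolyE raddf_sum => /msupp_sum_le/flatten_mapP[e _] /=.
rewrite /toric_map comp_mpolyZ -/(toric_map a _) => /msuppZ_le.
rewrite toric_mapX msuppX inE => /eqP ->.
by apply/sgspanP; exists e.
Qed.

End SemigroupRing.

Section Slices.
Variables (K : fieldType) (m N1 N2 : nat).
Variables (b : 'I_N2 -> 'X_{1..m}) (J : finType) (g : J -> {mpoly K[m]}).

(** The map [gaugmentation] on plain functions, for any finite family [g]; with [J = 'I_1] and
    [g = 1] it is [toric_map] itself. *)
Definition augment (u : J -> {mpoly K[N2]}) : {mpoly K[m]} :=
  \sum_j toric_map b (u j) * g j.

(** A K-linear functional on K[y], to be applied to each x-coefficient. It is not multiplicative in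
    general, so only additivity is declared. *)
Definition tcoef_of (gam : 'X_{1..m}) (h : {mpoly K[m]}) (f : {mpoly K[N2]}) : K :=
  (toric_map b f * h)@_gam.

Lemma tcoef_of_is_zmod_morphism gam h : zmod_morphism (tcoef_of gam h).
Proof. by move=> f1 f2; rewrite /tcoef_of raddfB mulrBl raddfB. Qed.

HB.instance Definition _ gam h :=
  GRing.isZmodMorphism.Build {mpoly K[N2]} K (tcoef_of gam h)
    (tcoef_of_is_zmod_morphism gam h).

Lemma tcoef_ofC gam h f c : tcoef_of gam h (f * c%:MP) = tcoef_of gam h f * c.
Proof.
by rewrite /tcoef_of rmorphM /= toric_mapC mulrAC mulrC mcoeffCM mulrC.
Qed.

(* The coefficient of t^gam in the image of w under the augmentation of the   *)
(* y-variables, K[x, y]^J -> K[x] (x) K[t].                                    *)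
Definition tslice (gam : 'X_{1..m}) (w : J -> {mpoly K[N1 + N2]}) :
    {mpoly K[N1]} :=
  \sum_j map_mpoly (tcoef_of gam (g j)) (poly_in_x (w j)).

(** The coefficient of x^e t^gam can be read in either order. This exchanges statements about slices
    over K[x] with statements about x-coefficients over K[y]. *)
Lemma mcoeff_tslice gam w e :
  (tslice gam w)@_e = (augment (fun j => xcoef e (w j)))@_gam.
Proof.
rewrite /tslice /augment !raddf_sum; apply: eq_bigr => j _ /=.
by rewrite mcoeff_map_mpoly.
Qed.

Lemma tslice_eq0 w : (forall gam, tslice gam w = 0) ->
  forall e, augment (fun j => xcoef e (w j)) = 0.
Proof.
by move=> w0 e; apply/mpolyP => gam; rewrite -mcoeff_tslice w0 !mcoeff0.
Qed.

Lemma eq_tslice gam w1 w2 : w1 =1 w2 -> tslice gam w1 = tslice gam w2.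
Proof. by move=> eqw; apply: eq_bigr => j _; rewrite eqw. Qed.

Lemma tsliceB gam w1 w2 :
  tslice gam (fun j => w1 j - w2 j) = tslice gam w1 - tslice gam w2.
Proof. by rewrite -sumrB; apply: eq_bigr => j _; rewrite !raddfB. Qed.

Lemma tslice_sum gam (I : finType) (w : I -> J -> {mpoly K[N1 + N2]}) :
  tslice gam (fun j => \sum_i w i j) = \sum_i tslice gam (w i).
Proof.
rewrite /tslice [RHS]exchange_big; apply: eq_bigr => j _.
by rewrite rmorph_sum raddf_sum.
Qed.

(** Augmenting the y-variables leaves K[x] alone, so the differential of F may be applied before or
    after slicing. *)
Lemma tsliceM1 gam w p :
  tslice gam (fun j => w j * incl1 N2 p) = tslice gam w * p.
Proof.
rewrite mulr_suml; apply: eq_bigr => j _; rewrite rmorphM /= poly_in_x_incl1.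
apply/mpolyP => e; rewrite mcoeff_map_mpoly !mcoeffM raddf_sum.
by apply: eq_bigr => k _; rewrite !mcoeff_map_mpoly /= tcoef_ofC.
Qed.

Lemma tslice_incl gam p u :
  tslice gam (fun j => incl1 N2 p * incl2 N1 (u j)) = (augment u)@_gam *: p.
Proof.
apply/mpolyP => e; rewrite mcoeff_tslice mcoeffZ mulrC -mcoeffZ; congr _@__.
rewrite scaler_sumr; apply: eq_bigr => j _.
by rewrite xcoef_incl /toric_map comp_mpolyZ scalerAl.
Qed.

(** Finitely many polynomials involve finitely many monomials of t; the bound makes sums over [gam]
    finite. *)
Lemma tslice_bounded (I : finType) (w : I -> J -> {mpoly K[N1 + N2]}) :
  exists B : nat, forall gam i, (B <= mdeg gam)%N -> tslice gam (w i) = 0.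
Proof.
exists (\max_(i : I) \max_(j : J) \max_(e <- msupp (poly_in_x (w i j)))
  msize (toric_map b (xcoef e (w i j)) * g j)) => gam i leB.
rewrite /tslice big1 // => j _; rewrite /map_mpoly /mmap big_seq big1 // => e se.
rewrite /= /tcoef_of memN_msupp_eq0 ?mpolyC0 ?mul0r //.
apply: msize_mdeg_ge; apply: leq_trans leB; apply: leq_trans (leq_bigmax i).
by apply: leq_trans (leq_bigmax j); exact: (bigmaxn_sup_seq e).
Qed.

(** The augmented image lies in the semigroup ring, so nonzero slices occur only at exponents for
    which [tslice_lift] can choose a preimage of t^gam. *)
Lemma tslice_sgspan gam w : (forall j, in_sgring (sgspan b) (g j)) ->
  tslice gam w != 0 -> sgspan b gam.
Proof.
move=> bg nz; have [e] : exists e, (tslice gam w)@_e != 0.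
  apply: contrapT => w0; move/eqP: nz; apply; apply/mpolyP => e.
  by rewrite mcoeff0; apply/eqP/negPn/negP => nze; apply: w0; exists e.
rewrite mcoeff_tslice -mcoeff_msupp; apply: in_sgring_sum => j _.
by apply: in_sgringM (bg j); [exact: sgspanD|exact: toric_map_sgring].
Qed.

(** K[x, y] is free over K[y] on the monomials in x, so a linear system with coefficients in K[y]
    can be solved separately for each x-coefficient. *)
Lemma incl2_flat (L : finType) (M : L -> J -> {mpoly K[N2]})
    (w : J -> {mpoly K[N1 + N2]}) :
    (forall e, exists v : L -> {mpoly K[N2]},
       forall j, xcoef e (w j) = \sum_l v l * M l j) ->
  exists v : L -> {mpoly K[N1 + N2]},
    forall j, w j = \sum_l v l * incl2 N1 (M l j).
Proof.
move=> /choice[v vP]; pose B := (\max_j msize (poly_in_x (w j)))%N.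
exists (fun l => \sum_(e : 'X_{1..N1 < B}) incl1 N2 'X_[e] * incl2 N1 (v e l)) => j.
rewrite {1}(xcoef_expand (leq_bigmax j : (_ <= B)%N)).
under [RHS]eq_bigr => l _ do rewrite mulr_suml.
rewrite exchange_big; apply: eq_bigr => e _; rewrite vP raddf_sum mulr_sumr.
by apply: eq_bigr => l _; rewrite /= rmorphM mulrA.
Qed.

(** With [U gam] a preimage of t^gam, the subtracted sum has the same slices as [w i]: it lifts the
    augmented image back to K[x, y]. *)
Lemma tslice_lift (I : finType) (w : I -> J -> {mpoly K[N1 + N2]}) :
    (forall j, in_sgring (sgspan b) (g j)) ->
    (forall gam, sgspan b gam -> exists u, augment u = 'X_[gam]) ->
  exists (B : nat) (U : 'X_{1..m} -> J -> {mpoly K[N2]}), forall i gam,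
    tslice gam (fun j => w i j - \sum_(del : 'X_{1..m < B})
                  incl1 N2 (tslice del (w i)) * incl2 N1 (U del j)) = 0.
Proof.
move=> bg lift; have [B Bw] := tslice_bounded w.
(* Outside the semigroup the value 0 is harmless, because the slices there vanish. *)
have /choice[U UP] : forall gam, exists u, sgspan b gam -> augment u = 'X_[gam].
  by move=> gam; have [/lift[u]|nb] := EM (sgspan b gam); [exists u|exists (fun=> 0)].
exists B, U => i gam; rewrite tsliceB tslice_sum; apply/eqP; rewrite subr_eq0.
have sliceU del : (augment (U del))@_gam *: tslice del (w i) =
    (del == gam)%:R *: tslice del (w i).
  have [->|/(tslice_sgspan bg)/UP->] := eqVneq (tslice del (w i)) 0.
    by rewrite !scaler0.
  by rewrite mcoeffX.
under eq_bigr => del _ do rewrite tslice_incl sliceU.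
(* Slices of degree at least [B] vanish, so truncating the sum loses nothing; below [B] only
   [del = gam] contributes. *)
have [ltB|/(Bw gam i) w0] := ltnP (mdeg gam) B; last first.
  by rewrite w0 big1 // => del _; case: eqP => [->|]; rewrite ?w0 ?scaler0 ?scale0r.
rewrite (bigD1 (BMultinom ltB)) //= eqxx scale1r big1 ?addr0 // => del.
by rewrite -val_eqE /= => /negPf->; rewrite scale0r.
Qed.

(* Exactness of the bicomplex F (x) G in the direction of F, read on its      *)
(* degree-0 column modulo the image of G_1.                                   *)
Lemma lift_boundary (I I' L : finType) (M : I' -> I -> {mpoly K[N1]})
    (M' : L -> J -> {mpoly K[N2]}) (w : I -> J -> {mpoly K[N1 + N2]}) :
    (forall j, in_sgring (sgspan b) (g j)) ->
    (forall gam, sgspan b gam -> exists u, augment u = 'X_[gam]) ->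
    (forall u, augment u = 0 -> exists v, forall j, u j = \sum_l v l * M' l j) ->
    (forall gam, exists v : I' -> {mpoly K[N1]},
       forall i, tslice gam (w i) = \sum_k v k * M k i) ->
  exists (W : I' -> J -> {mpoly K[N1 + N2]}) (V : I -> L -> {mpoly K[N1 + N2]}),
    forall i j, w i j = \sum_k W k j * incl1 N2 (M k i)
                      + \sum_l V i l * incl2 N1 (M' l j).
Proof.
move=> bg lift exact0 /choice[v vP].
have [B [U UP]] := tslice_lift w bg lift.
(* [W] combines the preimages [v] of the slices with the lifts [U], so that its image under [M] is
   the sum subtracted in [tslice_lift]. *)
pose W k j := \sum_(del : 'X_{1..m < B}) incl1 N2 (v del k) * incl2 N1 (U del j).
have WE i j : \sum_k W k j * incl1 N2 (M k i) =
    \sum_(del : 'X_{1..m < B}) incl1 N2 (tslice del (w i)) * incl2 N1 (U del j).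
  under eq_bigr => k _ do rewrite mulr_suml.
  rewrite exchange_big; apply: eq_bigr => del _; rewrite vP raddf_sum mulr_suml.
  by apply: eq_bigr => k _; rewrite /= rmorphM mulrAC.
(* The remainder has no slices; each of its x-coefficients is therefore killed by the augmentation
   and comes from [M']. *)
have /choice[V VP] : forall i, exists V : L -> {mpoly K[N1 + N2]},
    forall j, w i j - \sum_k W k j * incl1 N2 (M k i) =
              \sum_l V l * incl2 N1 (M' l j).
  move=> i; apply: incl2_flat => e; apply: exact0; apply: tslice_eq0 => gam.
  by rewrite -[RHS](UP i gam); apply: eq_tslice => j; rewrite WE.
by exists W, V => i j; rewrite -VP addrC subrK.
Qed.

End Slices.

(** * The augmentation over the join and direct sums of semigroups *)

Section JoinAugmentation.
Variables (K : fieldType) (m N1 N2 : nat).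
Variables (a : 'I_N1 -> 'X_{1..m}) (b : 'I_N2 -> 'X_{1..m}).

Lemma toric_map_incl1 p :
  toric_map (join_gens a b) (incl1 N2 p) = toric_map a p :> {mpoly K[m]}.
Proof.
apply: (mpoly_rmorph_ext (f := toric_map (join_gens a b) \o incl1 N2)
                         (g := toric_map a)) => [c|i] /=.
  by rewrite incl1C !toric_mapC.
rewrite incl1U !toric_mapU /join_gens.
by rewrite -[lshift _ _]/(unsplit (inl _)) unsplitK.
Qed.

Lemma toric_map_incl2 p :
  toric_map (join_gens a b) (incl2 N1 p) = toric_map b p :> {mpoly K[m]}.
Proof.
apply: (mpoly_rmorph_ext (f := toric_map (join_gens a b) \o incl2 N1)
                         (g := toric_map b)) => [c|i] /=.
  by rewrite incl2C !toric_mapC.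
rewrite incl2U !toric_mapU /join_gens.
by rewrite -[rshift _ _]/(unsplit (inr _)) unsplitK.
Qed.

(** In K[t] the degrees coming from x and from y are mixed: t^del collects all splittings of [del]
    into a part [k.1] from the y side and a part [k.2] from the x side. *)
Lemma mcoeff_toric_join f h1 h2 (del : 'X_{1..m}) :
  (toric_map (join_gens a b) f * (h1 * h2) : {mpoly K[m]})@_del =
    \sum_(k : 'X_{1..m < (mdeg del).+1, (mdeg del).+1} | del == (k.1 + k.2)%MM)
      (toric_map a (map_mpoly (tcoef_of b k.1 h2) (poly_in_x f)) * h1)@_k.2.
Proof.
rewrite {1}(xcoef_expand (leqnn (msize (poly_in_x f)))).
rewrite raddf_sum mulr_suml raddf_sum.
under eq_bigr => e _.
  rewrite /= rmorphM /= toric_map_incl1 toric_map_incl2 mulrACA mulrC mcoeffM.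
  over.
rewrite exchange_big; apply: eq_bigr => k _.
rewrite (map_mpolyE _ (leqnn (msize (poly_in_x f)))) raddf_sum mulr_suml raddf_sum.
apply: eq_bigr => e _ /=.
by rewrite /toric_map comp_mpolyZ -scalerAl mcoeffZ.
Qed.

Lemma augment_join (I J : finType) (f : I -> {mpoly K[m]})
    (g : J -> {mpoly K[m]}) z (del : 'X_{1..m}) :
  (\sum_i \sum_j toric_map (join_gens a b) (z i j) * (f i * g j))@_del =
    \sum_(k : 'X_{1..m < (mdeg del).+1, (mdeg del).+1} | del == (k.1 + k.2)%MM)
      (augment a f (fun i => tslice b g k.1 (z i)))@_k.2.
Proof.
under [RHS]eq_bigr => k _ do rewrite raddf_sum.
rewrite [RHS]exchange_big raddf_sum; apply: eq_bigr => i _.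
under [RHS]eq_bigr => k _ do rewrite raddf_sum mulr_suml raddf_sum.
rewrite [RHS]exchange_big raddf_sum; apply: eq_bigr => j _.
exact: mcoeff_toric_join.
Qed.

(** Injectivity of the sum map on the product of the two semigroups: once [be1 = be2], cancellation
    gives [al1 = al2]. *)
Definition sgspan_direct := forall al1 al2 be1 be2,
  sgspan a al1 -> sgspan a al2 -> sgspan b be1 -> sgspan b be2 ->
  (be1 + al1)%MM = (be2 + al2)%MM -> be1 = be2.

(** Directness lets t^(gam + al) arise from one pair only, so different slices cannot cancel. This
    encodes the injectivity of K[Gamma_1] (x) K[Gamma_2] -> K[t]. *)
Lemma augment_join_eq0 (I J : finType) (f : I -> {mpoly K[m]})
    (g : J -> {mpoly K[m]}) z :
    sgspan_direct ->
    (forall i, in_sgring (sgspan a) (f i)) ->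
    (forall j, in_sgring (sgspan b) (g j)) ->
    \sum_i \sum_j toric_map (join_gens a b) (z i j) * (f i * g j) = 0 ->
  forall gam, augment a f (fun i => tslice b g gam (z i)) = 0.
Proof.
move=> dir af bg z0 gam; apply/mpolyP => al; rewrite mcoeff0; apply/eqP.
pose A ga := augment a f (fun i => tslice b g ga (z i)); rewrite -/(A gam).
have suppA ga al' : (A ga)@_al' != 0 -> sgspan b ga /\ sgspan a al'.
  move=> nz; split; last first.
    move: nz; rewrite -mcoeff_msupp; apply: in_sgring_sum => i _.
    by apply: in_sgringM (af i); [exact: sgspanD|exact: toric_map_sgring].
  apply: contrapT => nb; move/eqP: nz; apply.
  rewrite /A /augment big1 ?mcoeff0 // => i _.
  have [->|/(tslice_sgspan bg)//] := eqVneq (tslice b g ga (z i)) 0.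
  by rewrite raddf0 mul0r.
have [//|nz] := boolP ((A gam)@_al == 0); have [bgam aal] := suppA _ _ nz.
(* These bounds place the pair [(gam, al)] in the finite index type of [augment_join]. *)
have lt1 : (mdeg gam < (mdeg (gam + al)).+1)%N by rewrite mdegD ltnS leq_addr.
have lt2 : (mdeg al < (mdeg (gam + al)).+1)%N by rewrite mdegD ltnS leq_addl.
have := augment_join f g z (gam + al)%MM.
rewrite z0 mcoeff0 (bigD1 (BMultinom lt1, BMultinom lt2)) //= big1 ?addr0.
  by move=> /esym/eqP; rewrite -/(A gam) (negPf nz).
case=> k1 k2 /= /andP[/eqP eqk nk]; apply/eqP/negPn/negP => /suppA[bk ak].
have eq1 := dir _ _ _ _ aal ak bgam bk eqk.
have eq2 : al = k2 by move: eqk; rewrite [in RHS]/= -eq1 => /addmI.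
by case/negP: nk; rewrite xpair_eqE -!val_eqE /= -eq1 -eq2 !eqxx.
Qed.

End JoinAugmentation.

(** * The tensor product of two resolutions *)

Lemma sum_codom (I T : finType) (h : I -> T) (V : nmodType) (Q : T -> V) :
  injective h -> (forall x, Q x != 0 -> exists i, x = h i) ->
  \sum_x Q x = \sum_i Q (h i).
Proof.
move=> inj_h Qh; rewrite (bigID (mem (h @: [set: I]))) /= [X in _ + X]big1 => [|x].
  rewrite addr0 big_imset => [|i j _ _ /inj_h//].
  by apply: eq_bigl => i; rewrite in_setT.
by apply: contraNeq => /Qh[i ->]; apply: imset_f.
Qed.

Lemma untag_Tagged (I : eqType) (T_ : I -> Type) (R : Type) (x0 : R) (i : I)
    (f : T_ i -> R) (x : T_ i) :
  untag x0 f (Tagged T_ x) = f x.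
Proof. exact: (untagE _ _ (erefl : tag (Tagged T_ x) = i)). Qed.

Lemma Tagged_inj (I : eqType) (T_ : I -> eqType) (i : I) :
  injective (@Tagged I i T_).
Proof. by move=> x y /eqP; rewrite eq_Tagged => /eqP. Qed.

Section Resolution.
Variables (K : fieldType) (m N : nat) (a : 'I_N -> 'X_{1..m}).
Variable H : free_complex K m N.

Lemma gdiff_ffun n (u : gbasis H n.+1 -> {mpoly K[N]}) j :
  gdiff ([ffun i => u i] : gmod H n.+1) j = \sum_i u i * gcoef H i j.
Proof. by rewrite ffunE; apply: eq_bigr => i _; rewrite ffunE. Qed.

Lemma gdiff_basis n (k : gbasis H n.+1) j :
  gdiff ([ffun i => (i == k)%:R] : gmod H n.+1) j = gcoef H k j.
Proof.
rewrite gdiff_ffun (bigD1 k) //= eqxx mul1r big1 ?addr0 // => i /negPf->.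
by rewrite mul0r.
Qed.

Lemma gaugmentation_ffun (u : gbasis H 0 -> {mpoly K[N]}) :
  gaugmentation a ([ffun i => u i] : gmod H 0) = augment a (gaug H) u.
Proof. by apply: eq_bigr => i _; rewrite ffunE. Qed.

Hypothesis resH : resolves a H.

Lemma resolves_exact n (u : gbasis H n.+1 -> {mpoly K[N]}) :
    (forall j, \sum_i u i * gcoef H i j = 0) ->
  exists v, forall i, u i = \sum_k v k * gcoef H k i.
Proof.
case: resH => _ _ _ exH u0.
have /(exH n)[v vE] : gdiff ([ffun i => u i] : gmod H n.+1) = 0.
  by apply/ffunP => j; rewrite gdiff_ffun u0 ffunE.
by exists v => i; rewrite -[LHS](ffunE u) vE ffunE.
Qed.

Lemma resolves_complex n (k : gbasis H n.+2) (j : gbasis H n) :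
  \sum_i gcoef H k i * gcoef H i j = 0.
Proof.
case: resH => _ _ _ exH; pose v : gmod H n.+2 := [ffun i => (i == k)%:R].
have /ffunP/(_ j) : gdiff (gdiff v) = 0 by apply/exH; exists v.
rewrite [gdiff _ _]ffunE [RHS]ffunE => dv; rewrite -[RHS]dv.
by apply: eq_bigr => i _; rewrite gdiff_basis.
Qed.

Lemma resolves_exact0 (u : gbasis H 0 -> {mpoly K[N]}) :
  augment a (gaug H) u = 0 -> exists v, forall i, u i = \sum_k v k * gcoef H k i.
Proof.
case: resH => _ _ exH _; rewrite -gaugmentation_ffun => /exH[v vE].
by exists v => i; rewrite -[LHS](ffunE u) vE ffunE.
Qed.

Lemma resolves_complex0 (k : gbasis H 1) : augment a (gaug H) (gcoef H k) = 0.
Proof.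
case: resH => _ _ exH _; pose v : gmod H 1 := [ffun i => (i == k)%:R].
have dv : gaugmentation a (gdiff v) = 0 by apply/exH; exists v.
rewrite -[RHS]dv.
by apply: eq_bigr => i _; rewrite gdiff_basis.
Qed.

Lemma resolves_lift gam :
  sgspan a gam -> exists u, augment a (gaug H) u = 'X_[gam].
Proof.
case: resH => _ surj _ _ agam.
have [|u uE] := surj 'X_[gam]; first by move=> g; rewrite msuppX inE => /eqP->.
by exists u.
Qed.

Lemma resolves_gaug i : in_sgring (sgspan a) (gaug H i).
Proof. by case: resH. Qed.

End Resolution.

(** * The total complex as functions on pairs of basis elements *)

Section TensorExactness.
Variables (K : fieldType) (m N1 N2 : nat).
Variables (F : free_complex K m N1) (G : free_complex K m N2).

(** Elements of F (x) G are handled as functions on pairs of basis elements of all degrees, which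
    avoids transport along p + q = n. An element of degree n is represented by the values at pairs
    of total degree n. *)
Local Notation cochain :=
  ({p : nat & gbasis F p} -> {q : nat & gbasis G q} -> {mpoly K[N1 + N2]}).

Lemma tbasis_inj n (x y : tbasis F G n) :
  tfst x = tfst y -> tsnd x = tsnd y -> x = y.
Proof.
case: x y => [p [i j]] [p' [i' j']] eqF eqG.
have eqp : p = p' by apply/val_inj/(congr1 tag eqF).
case: _ / eqp i' j' eqF eqG => i' j' /eqP + /eqP.
rewrite /tfst /tsnd /= !eq_Tagged /= => /eqP -> /eqP ->.
by [].
Qed.

Lemma tbasis_lift n X Y : (tag X + tag Y)%N = n ->
  {x : tbasis F G n | tfst x = X & tsnd x = Y}.
Proof.
case: X Y => [p i] [q j] /= def_n; have lt_p : (p < n.+1)%N by lia.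
have def_q : (n - Ordinal lt_p)%N = q by rewrite /=; lia.
case: _ / def_q j => j.
by exists (existT (fun p : 'I_n.+1 => (gbasis F p * gbasis G (n - p))%type)
          (Ordinal lt_p) (i, j)).
Qed.

Lemma tag_tbasis n (x : tbasis F G n) : (tag (tfst x) + tag (tsnd x))%N = n.
Proof. by rewrite /= subnKC // -ltnS. Qed.

Definition dleft (z : cochain) : cochain := fun X Y =>
  \sum_i z (Tagged (gbasis F) i) Y * incl1 N2 (gcoef F i (tagged X)).

Definition dright (z : cochain) : cochain := fun X Y =>
  \sum_j z X (Tagged (gbasis G) j) * incl2 N1 (gcoef G j (tagged Y)).

(** The sign can be read at the target, because [dright] stays in the column [tag X]. *)
Definition tdiff (z : cochain) : cochain := fun X Y =>
  dleft z X Y + (-1) ^+ tag X * dright z X Y.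

(** A basis element contributes at [y] only if it agrees with [y] in one factor and lies one degree
    higher in the other. Each of these two families is enumerated by a map [h]. *)
Lemma gdiff_tensor n (u : gmod (tensor_complex F G) n.+1) (z : cochain) :
    (forall x, u x = z (tfst x) (tsnd x)) ->
  forall y : tbasis F G n, gdiff u y = tdiff z (tfst y) (tsnd y).
Proof.
move=> uE y; rewrite ffunE.
under eq_bigr => x _ do rewrite uE mulrDr.
rewrite big_split /=; congr (_ + _).
  have lift i : {x : tbasis F G n.+1 | tfst x = Tagged (gbasis F) (i : gbasis F (tag (tfst y)).+1) &
                  tsnd x = tsnd y}.
    by apply: tbasis_lift; rewrite -(congr1 succn (tag_tbasis y)); apply: addSn.
  pose h i : tbasis F G n.+1 := s2val (lift i).
  have hF i : tfst (h i) = Tagged (gbasis F) i by rewrite /h; case: (lift i).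
  have hG i : tsnd (h i) = tsnd y by rewrite /h; case: (lift i).
  rewrite (sum_codom (h := h)) => [|i i' eq_h|x nz].
  - by apply: eq_bigr => i _; rewrite hF hG eqxx /dcoef untag_Tagged.
  - by apply: (@Tagged_inj _ (gbasis F)); rewrite -!hF eq_h.
  - have eqG : tsnd x = tsnd y.
      by apply/eqP; apply: contraNT nz => /negPf->; rewrite mulr0n mulr0.
    have eqp : tag (tfst x) = (tag (tfst y)).+1.
      apply/eqP; apply: contraNT nz => neq.
      by rewrite /dcoef (untag_dflt _ _ neq) raddf0 mul0rn mulr0.
    exists (etagged eqp); apply: tbasis_inj; rewrite ?hG ?hF //.
    by rewrite etaggedK.
have lift j : {x : tbasis F G n.+1 | tfst x = tfst y &
                tsnd x = Tagged (gbasis G) (j : gbasis G (tag (tsnd y)).+1)}.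
  by apply: tbasis_lift; rewrite -(congr1 succn (tag_tbasis y)); apply: addnS.
pose h j : tbasis F G n.+1 := s2val (lift j).
have hF j : tfst (h j) = tfst y by rewrite /h; case: (lift j).
have hG j : tsnd (h j) = Tagged (gbasis G) j by rewrite /h; case: (lift j).
rewrite (sum_codom (h := h)) => [|j j' eq_h|x nz].
- rewrite mulr_sumr; apply: eq_bigr => j _; rewrite hF hG eqxx /dcoef untag_Tagged.
  by rewrite -[nat_of_ord (tag (h j))]/(tag (tfst (h j))) hF mulrCA.
- by apply: (@Tagged_inj _ (gbasis G)); rewrite -!hG eq_h.
- have eqF : tfst x = tfst y.
    by apply/eqP; apply: contraNT nz => /negPf->; rewrite mulr0n mulr0.
  have eqq : tag (tsnd x) = (tag (tsnd y)).+1.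
    apply/eqP; apply: contraNT nz => neq.
    by rewrite /dcoef (untag_dflt _ _ neq) raddf0 mulr0 mul0rn mulr0.
  exists (etagged eqq); apply: tbasis_inj; rewrite ?hG ?hF //.
  by rewrite etaggedK.
Qed.

(** By [tbasis_inj] the sum has at most one term; it is empty, hence 0, at pairs of another total
    degree. *)
Definition cochain_of n (u : gmod (tensor_complex F G) n) : cochain :=
  fun X Y => \sum_(x : tbasis F G n | (tfst x == X) && (tsnd x == Y)) u x.

Lemma cochain_ofE n (u : gmod (tensor_complex F G) n) (x : tbasis F G n) :
  u x = cochain_of u (tfst x) (tsnd x).
Proof.
rewrite /cochain_of (big_pred1 x) // => y.
by apply/andP/eqP => [[/eqP eqF /eqP eqG]|->]; [apply: tbasis_inj|].
Qed.

Lemma gaugmentation_tensor (a : 'I_(N1 + N2) -> 'X_{1..m})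
    (u : gmod (tensor_complex F G) 0) (z : cochain) :
    (forall x, u x = z (tfst x) (tsnd x)) ->
  gaugmentation a u = \sum_i \sum_j
    toric_map a (z (Tagged (gbasis F) i) (Tagged (gbasis G) j)) *
      (gaug F i * gaug G j).
Proof.
move=> uE; rewrite pair_big /=.
have lift ij : {x : tbasis F G 0 | tfst x = Tagged (gbasis F) (ij.1 : gbasis F 0)
    & tsnd x = Tagged (gbasis G) (ij.2 : gbasis G 0)}.
  exact: tbasis_lift.
pose h ij : tbasis F G 0 := s2val (lift ij).
have hF ij : tfst (h ij) = Tagged (gbasis F) (ij.1) by rewrite /h; case: (lift ij).
have hG ij : tsnd (h ij) = Tagged (gbasis G) (ij.2) by rewrite /h; case: (lift ij).
rewrite /gaugmentation (sum_codom (h := h)) => [|[i j] [i' j'] eq_h|x _].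
- by apply: eq_bigr => ij _; rewrite uE /= /taug !hF !hG /daug !untag_Tagged.
- have := hF (i, j); have := hG (i, j); rewrite eq_h hF hG /=.
  by move=> /(@Tagged_inj _ (gbasis G))-> /(@Tagged_inj _ (gbasis F))->.
- have /eqP := tag_tbasis x; rewrite addn_eq0 => /andP[/eqP p0 /eqP q0].
  exists (etagged p0, etagged q0).
  by apply: tbasis_inj; rewrite ?hF ?hG etaggedK.
Qed.

Lemma dleft_dright z X Y : dleft (dright z) X Y = dright (dleft z) X Y.
Proof.
rewrite /dleft /dright; under eq_bigr => i _ do rewrite mulr_suml.
rewrite exchange_big; apply: eq_bigr => j _; rewrite mulr_suml.
by apply: eq_bigr => i _; rewrite mulrAC.
Qed.

Lemma tdiffD z1 z2 X Y :
  tdiff (fun X Y => z1 X Y + z2 X Y) X Y = tdiff z1 X Y + tdiff z2 X Y.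
Proof.
rewrite /tdiff addrACA -mulrDr /dleft /dright -!big_split /=.
by congr (_ + _ * _); apply: eq_bigr => i _; rewrite mulrDl.
Qed.

Lemma tdiffB z1 z2 X Y :
  tdiff (fun X Y => z1 X Y - z2 X Y) X Y = tdiff z1 X Y - tdiff z2 X Y.
Proof.
apply/eqP; rewrite eq_sym subr_eq -tdiffD; apply/eqP.
by congr (_ + _ * _); apply: eq_bigr => i _; rewrite subrK.
Qed.

(** The extension of [W] by zero to all other bidegrees. *)
Definition bidegree p q (W : gbasis F p -> gbasis G q -> {mpoly K[N1 + N2]}) :
  cochain := fun X Y => untag 0 (fun i => untag 0 (W i) Y) X.

Lemma bidegree_diag p q W i j :
  @bidegree p q W (Tagged (gbasis F) i) (Tagged (gbasis G) j) = W i j.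
Proof. by rewrite /bidegree !untag_Tagged. Qed.

Lemma bidegree_off p q W X Y :
  (tag X != p) || (tag Y != q) -> @bidegree p q W X Y = 0.
Proof.
rewrite /bidegree; case/orP=> neq; first by rewrite untag_dflt.
by rewrite /untag; case: eqP => // e; case: eqP neq => // ->; rewrite eqxx.
Qed.

Lemma dleft_bidegree p q W (i : gbasis F p) (j : gbasis G q) :
  dleft (@bidegree p.+1 q W) (Tagged (gbasis F) i) (Tagged (gbasis G) j) =
    \sum_k W k j * incl1 N2 (gcoef F k i).
Proof. by apply: eq_bigr => k _; rewrite bidegree_diag. Qed.

Lemma dright_bidegree p q W (i : gbasis F p) (j : gbasis G q) :
  dright (@bidegree p q.+1 W) (Tagged (gbasis F) i) (Tagged (gbasis G) j) =
    \sum_l W i l * incl2 N1 (gcoef G l j).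
Proof. by apply: eq_bigr => l _; rewrite bidegree_diag. Qed.

Lemma dleft_bidegree_off p q W X Y :
  ((tag X).+1 != p) || (tag Y != q) -> dleft (@bidegree p q W) X Y = 0.
Proof. by move=> neq; rewrite /dleft big1 // => k _; rewrite bidegree_off ?mul0r. Qed.

Lemma dright_bidegree_off p q W X Y :
  (tag X != p) || ((tag Y).+1 != q) -> dright (@bidegree p q W) X Y = 0.
Proof. by move=> neq; rewrite /dright big1 // => k _; rewrite bidegree_off ?mul0r. Qed.

(** * Exactness of the total complex *)

Variables (a : 'I_N1 -> 'X_{1..m}) (b : 'I_N2 -> 'X_{1..m}).
Hypotheses (resF : resolves a F) (resG : resolves b G).
Hypothesis dir : sgspan_direct a b.

Lemma tdiffK z X Y : tdiff (tdiff z) X Y = 0.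
Proof.
have ll : dleft (dleft z) X Y = 0.
  rewrite /dleft /=; under eq_bigr => i _ do rewrite mulr_suml.
  rewrite exchange_big big1 // => k _; under eq_bigr => i _ do rewrite -mulrA -rmorphM.
  by rewrite -mulr_sumr -raddf_sum (resolves_complex resF) raddf0 mulr0.
have rr : dright (dright z) X Y = 0.
  rewrite /dright /=; under eq_bigr => i _ do rewrite mulr_suml.
  rewrite exchange_big big1 // => k _; under eq_bigr => i _ do rewrite -mulrA -rmorphM.
  by rewrite -mulr_sumr -raddf_sum (resolves_complex resG) raddf0 mulr0.
(* Inside [dleft] the argument sits in column [tag X + 1], hence the opposite sign, which cancels
   the two mixed terms. *)
have dl : dleft (tdiff z) X Y =
    dleft (dleft z) X Y + (-1) ^+ (tag X).+1 * dleft (dright z) X Y.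
  rewrite /tdiff {1}/dleft mulr_sumr -big_split.
  by apply: eq_bigr => i _; rewrite mulrDl mulrA.
have dr : dright (tdiff z) X Y =
    dright (dleft z) X Y + (-1) ^+ tag X * dright (dright z) X Y.
  rewrite /tdiff {1}/dright mulr_sumr -big_split.
  by apply: eq_bigr => i _; rewrite mulrDl mulrA.
rewrite {1}/tdiff dl dr ll rr dleft_dright add0r mulr0 addr0 exprS.
by rewrite mulN1r mulNr addNr.
Qed.

(** The augmentation of G kills boundaries from G_1, and this passes to each x-coefficient; slices
    therefore see only F (x) K[Gamma_2]. *)
Lemma tslice_dright gam (w : gbasis G 1 -> {mpoly K[N1 + N2]}) :
  tslice b (gaug G) gam (fun j => \sum_l w l * incl2 N1 (gcoef G l j)) = 0.
Proof.
apply/mpolyP => e; rewrite mcoeff_tslice mcoeff0 /augment.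
under eq_bigr => j _ do rewrite !raddf_sum mulr_suml.
rewrite exchange_big big1 ?mcoeff0 // => l _.
under eq_bigr => j _ do rewrite /= xcoefM2 rmorphM -mulrA.
by rewrite -mulr_sumr [X in _ * X](resolves_complex0 resG) mulr0.
Qed.

(* z vanishes in the columns tag X >= P: clear the columns P - 1, P - 2, ...  *)
Lemma column_boundary n P (z : cochain) : (P <= n.+1)%N ->
    (forall X Y, (tag X + tag Y)%N = n -> tdiff z X Y = 0) ->
    (forall X Y, (tag X + tag Y)%N = n.+1 -> (P <= tag X)%N -> z X Y = 0) ->
  exists w, forall X Y, (tag X + tag Y)%N = n.+1 -> z X Y = tdiff w X Y.
Proof.
elim: P z => [|P IH] z lePn cyc z0.
  exists (fun _ _ => 0) => X Y /z0->//.
  by rewrite /tdiff /dleft /dright !big1 ?mulr0 ?addr0 // => i _; rewrite mul0r.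
have def_q : (P + (n - P))%N = n by rewrite subnKC.
(* At bidegree (P, n - P) the cycle equation receives nothing from column P + 1, so column [P] of
   [z] is a cycle for G. Its row n - P + 1 is positive, so exactness of G applies there without the
   augmentation. *)
have /choice[V VP] : forall i : gbasis F P, exists V,
    forall j : gbasis G (n - P).+1, z (Tagged (gbasis F) i) (Tagged (gbasis G) j) =
      \sum_l V l * incl2 N1 (gcoef G l j).
  move=> i; apply: incl2_flat => e; apply: (resolves_exact resG) => j.
  have := cyc (Tagged (gbasis F) i) (Tagged (gbasis G) j) def_q.
  rewrite /tdiff {1}/dleft big1 ?add0r => [|k _]; last first.
    by rewrite z0 ?mul0r //= addSn def_q.
  move/(canRL (signrMK P)); rewrite mulr0 => /(congr1 (xcoef e)).
  rewrite raddf0 raddf_sum => {2}<-.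
  by apply: eq_bigr => l _; rewrite /= xcoefM2.
(* The sign cancels the one in [tdiff]. Besides column [P], the boundary of [w0] reaches only column
   P - 1, which is cleared later. *)
pose w0 := bidegree (fun i l => (-1) ^+ P * V i l).
have dw0 X Y : (tag X + tag Y)%N = n.+1 -> (P <= tag X)%N ->
    z X Y - tdiff w0 X Y = 0.
  case: X Y => p i [q j] /= eq_pq; rewrite leq_eqVlt => /orP[/eqP eqP|ltP].
    case: _ / eqP i eq_pq => i eq_pq.
    have eq_q : (n - P).+1 = q by lia.
    case: _ / eq_q j eq_pq => j _.
    rewrite /tdiff dleft_bidegree_off ?add0r /=; last by lia.
    rewrite dright_bidegree VP mulr_sumr -sumrB big1 // => l _.
    by rewrite -mulrA signrMK subrr.
  rewrite z0 //= /tdiff dleft_bidegree_off ?dright_bidegree_off ?mulr0 ?addr0 ?subr0 //=; lia.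
have [||X Y|w1 w1P] := IH (fun X Y => z X Y - tdiff w0 X Y).
- exact: ltnW.
- by move=> X Y XY; rewrite tdiffB tdiffK cyc ?subr0.
- by move=> XY leP; apply: dw0.
exists (fun X Y => w0 X Y + w1 X Y) => X Y XY.
by rewrite tdiffD -w1P // addrC subrK.
Qed.

(** The condition [n <= tag X] singles out bidegree (n, 0). There [lift_boundary] gives an
    F-boundary from bidegree (n + 1, 0) plus a G-boundary from (n, 1), the latter with a sign to
    match [tdiff]. *)
Lemma tdiff_corner n (z : cochain) :
    (forall gam, exists v, forall i : gbasis F n,
       tslice b (gaug G) gam
         (fun j => z (Tagged (gbasis F) i) (Tagged (gbasis G) j)) =
       \sum_k v k * gcoef F k i) ->
  exists w, forall X Y, (tag X + tag Y)%N = n -> (n <= tag X)%N ->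
    z X Y = tdiff w X Y.
Proof.
move=> /(lift_boundary (resolves_gaug resG) (resolves_lift resG)
           (@resolves_exact0 _ _ _ _ _ resG))[W [V WV]].
exists (fun X Y => bidegree W X Y + bidegree (fun i l => (-1) ^+ n * V i l) X Y).
case=> p i [q j] /= eq_pq le_np.
have [eq_p eq_q] : n = p /\ 0%N = q by lia.
case: _ / eq_p i {eq_pq le_np} => i; case: _ / eq_q j => j.
rewrite WV tdiffD /tdiff dleft_bidegree dright_bidegree.
rewrite dleft_bidegree_off ?dright_bidegree_off /=; try by lia.
rewrite mulr0 addr0 add0r mulr_sumr; congr (_ + _); apply: eq_bigr => l _.
by rewrite mulrA signrMK.
Qed.

(** At bidegree (n, 0) the cycle equation makes [dleft z] a G-boundary, which has no slices. Hence
    the slices of the part in bidegree (n + 1, 0) are F-cycles, thus F-boundaries; [tdiff_corner]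
    clears this part and [column_boundary] the rest. *)
Lemma tensor_exact n (z : cochain) :
    (forall X Y, (tag X + tag Y)%N = n -> tdiff z X Y = 0) ->
  exists w, forall X Y, (tag X + tag Y)%N = n.+1 -> z X Y = tdiff w X Y.
Proof.
move=> cyc; have [|w0 w0P] := @tdiff_corner n.+1 z.
  move=> gam; apply: (resolves_exact resF) => i.
  under eq_bigr => k _ do rewrite -tsliceM1.
  rewrite -tslice_sum -[RHS](tslice_dright gam
    (fun l => - (-1) ^+ n * z (Tagged (gbasis F) i) (Tagged (gbasis G) l))).
  apply: eq_tslice => j.
  have := cyc (Tagged (gbasis F) i) (Tagged (gbasis G) j) (addn0 n).
  move/eqP; rewrite addr_eq0 => /eqP eq_d.
  rewrite -[LHS]/(dleft z (Tagged (gbasis F) i) (Tagged (gbasis G) j)) eq_d /= -mulNr mulr_sumr.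
  by apply: eq_bigr => l _; rewrite mulrA.
have [|||w1 w1P] := @column_boundary n n.+1 (fun X Y => z X Y - tdiff w0 X Y).
- exact: leqnn.
- by move=> X Y XY; rewrite tdiffB tdiffK cyc ?subr0.
- by move=> X Y XY leX; rewrite w0P ?subrr.
exists (fun X Y => w0 X Y + w1 X Y) => X Y XY.
by rewrite tdiffD -w1P // addrC subrK.
Qed.

(** In degree 0 the role of the cycle equation is taken by the augmentation: [augment_join_eq0]
    splits its vanishing into slices, and here directness enters the exactness proof. *)
Lemma tensor_exact0 (z : cochain) :
    \sum_i \sum_j
      toric_map (join_gens a b) (z (Tagged (gbasis F) i) (Tagged (gbasis G) j)) *
        (gaug F i * gaug G j) = 0 ->
  exists w, forall X Y, (tag X + tag Y)%N = 0%N -> z X Y = tdiff w X Y.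
Proof.
move=> z0; have [|w wP] := @tdiff_corner 0 z; last by exists w => X Y XY; apply: wP.
move=> gam; apply: (resolves_exact0 resF).
exact: (augment_join_eq0 dir (resolves_gaug resF) (resolves_gaug resG) z0).
Qed.

Lemma tensor_complex0 (z : cochain) :
  \sum_i \sum_j
      toric_map (join_gens a b) (tdiff z (Tagged (gbasis F) i) (Tagged (gbasis G) j)) *
        (gaug F i * gaug G j) = 0.
Proof.
under eq_bigr => i _.
  under eq_bigr => j _ do rewrite /tdiff expr0 mul1r raddfD mulrDl.
  rewrite big_split /=; over.
rewrite big_split /= [X in X + _]exchange_big /= !big1 ?addr0 // => [i|j] _.
  rewrite /dright /=; under eq_bigr => j _ do rewrite raddf_sum mulr_suml.
  rewrite exchange_big big1 // => l _.
  under eq_bigr => j _ do rewrite /= rmorphM /= toric_map_incl2 mulrACA.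
  by rewrite -mulr_sumr [X in _ * X](resolves_complex0 resG) mulr0.
rewrite /dleft /=; under eq_bigr => i _ do rewrite raddf_sum mulr_suml.
rewrite exchange_big big1 // => k _.
under eq_bigr => i _ do rewrite /= rmorphM /= toric_map_incl1 [X in X * _]mulrC mulrACA.
by rewrite -mulr_suml [X in X * _](resolves_complex0 resF) mul0r.
Qed.

End TensorExactness.

(** * Extremal rays *)

Section ExtremalRays.
Variables (R : realType) (m N : nat) (a : 'I_N -> 'X_{1..m}).

Local Notation vec := (vec_of R).

Lemma vecD (g h : 'X_{1..m}) : vec (g + h)%MM = vec g + vec h.
Proof. by apply/rowP => k; rewrite !mxE mnmDE natrD. Qed.

Lemma vecMn (g : 'X_{1..m}) n : vec (g *+ n)%MM = n%:R *: vec g.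
Proof. by apply/rowP => k; rewrite !mxE mulmnE natrM mulrC. Qed.

Lemma vec0 : vec (0%MM : 'X_{1..m}) = 0.
Proof. by apply/rowP => k; rewrite !mxE mnm0E. Qed.

Lemma vec_inj : injective (vec : 'X_{1..m} -> 'rV[R]_m).
Proof.
move=> g h /rowP eq_gh; apply/mnmP => k; have /eqP := eq_gh k.
by rewrite !mxE eqr_nat => /eqP.
Qed.

(** A zero generator could be dropped from the generating set. *)
Lemma minimally_generating_neq0 i : minimally_generating a -> a i <> 0%MM.
Proof.
move=> min_a ai0; have /setP/(_ i) : [set~ i] = [set: 'I_N].
  apply: min_a => g [c ->]; exists c.
  rewrite (bigD1 i) ?in_setT //= ai0.
  have -> : (0 *+ c i = 0 :> 'X_{1..m})%MM by apply/mnmP => k; rewrite mulmnE mnm0E.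
  by rewrite add0m; apply: eq_bigl => j; rewrite !inE.
by rewrite !inE eqxx.
Qed.

Definition cone_on (J : {set 'I_N}) (v : 'rV[R]_m) : Prop :=
  exists alpha : 'I_N -> R,
    (forall i, 0 <= alpha i) /\ v = \sum_(i in J) alpha i *: vec (a i).

Lemma cone_onT v : in_cone a v -> cone_on [set: 'I_N] v.
Proof.
case=> al [al0 ->]; exists al; split=> //.
by apply: eq_bigl => i; rewrite in_setT.
Qed.

Lemma cone_on_in_cone J v : cone_on J v -> in_cone a v.
Proof.
case=> al [al0 ->]; exists (fun i => if i \in J then al i else 0); split.
  by move=> i; case: ifP.
rewrite [LHS]big_mkcond; apply: eq_bigr => i _.
by case: ifP; rewrite ?scale0r.
Qed.

Lemma cone_on0 J : cone_on J 0.
Proof.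
by exists (fun=> 0); split=> //; rewrite big1 // => i _; rewrite scale0r.
Qed.

Lemma cone_onD J u v : cone_on J u -> cone_on J v -> cone_on J (u + v).
Proof.
move=> [al [al0 ->]] [be [be0 ->]]; exists (fun i => al i + be i); split.
  by move=> i; rewrite addr_ge0.
by rewrite -big_split; apply: eq_bigr => i _; rewrite scalerDl.
Qed.

Lemma cone_onZ J l v : 0 <= l -> cone_on J v -> cone_on J (l *: v).
Proof.
move=> l0 [al [al0 ->]]; exists (fun i => l * al i); split.
  by move=> i; rewrite mulr_ge0.
by rewrite scaler_sumr; apply: eq_bigr => i _; rewrite scalerA.
Qed.

Lemma cone_on_sum J (P : pred 'I_N) (al : 'I_N -> R) :
    (forall i, P i -> cone_on J (vec (a i))) -> (forall i, 0 <= al i) ->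
  cone_on J (\sum_(i | P i) al i *: vec (a i)).
Proof.
move=> gen al0; elim/big_rec: _ => [|i v Pi Jv]; first exact: cone_on0.
by apply: cone_onD => //; apply: cone_onZ => //; apply: gen.
Qed.

(** Redundant generators are discarded one at a time, by induction on the cardinality of [J]. *)
Lemma irredundant_cone (J : {set 'I_N}) : (forall i, cone_on J (vec (a i))) ->
  exists J' : {set 'I_N}, (forall i, cone_on J' (vec (a i))) /\
    forall j, j \in J' -> ~ cone_on (J' :\ j) (vec (a j)).
Proof.
have [n] := ubnP #|J|; elim: n J => // n IH J ltJ genJ.
have [[j [jJ redj]]|irr] := EM (exists j, j \in J /\ cone_on (J :\ j) (vec (a j))).
  apply: (IH (J :\ j)); first by move: ltJ; rewrite (cardsD1 j J) jJ.
  move=> i; have [al [al0 ->]] := genJ i; rewrite (bigD1 j) //=.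
  apply: cone_onD; first exact: cone_onZ.
  apply: cone_on_sum => // k /andP[kJ nkj].
  exists (fun l => (l == k)%:R); split=> [l|]; first exact: ler0n.
  rewrite (bigD1 k) ?inE ?nkj //= eqxx scale1r big1 ?addr0 // => l /andP[_ /negPf->].
  by rewrite scale0r.
by exists J; split=> // j jJ redj; apply: irr; exists j.
Qed.

(** In a relation l a_j = sum of ga_i a_i over [J], a coefficient ga_j < l contradicts irredundancy.
    Otherwise the terms with i <> j add up to a vector without positive coordinates; since
    generators are nonzero with entries in N, all these ga_i vanish. *)
Lemma extremal_of_irredundant (J : {set 'I_N}) j :
    minimally_generating a ->
    (forall i, cone_on J (vec (a i))) -> j \in J ->
    ~ cone_on (J :\ j) (vec (a j)) ->
  spans_cone_extremal_ray a (vec (a j)).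
Proof.
move=> min_a genJ jJ irr; split.
- by apply: (cone_on_in_cone (genJ j)).
- by apply/eqP; rewrite -vec0 => /vec_inj; apply: minimally_generating_neq0.
have coneJ v : in_cone a v -> cone_on J v.
  by case=> al [al0 ->]; apply: cone_on_sum.
move=> x y /coneJ[al [al0 ->]] /coneJ[be [be0 ->]] [l l0].
pose ga i := al i + be i.
rewrite -big_split /=; under eq_bigr => i _ do rewrite -scalerDl -/(ga i).
have ga0 i : 0 <= ga i by rewrite addr_ge0.
rewrite (bigD1 j) //= => eq_l; have [lt_l|le_l] := ltP (ga j) l.
  have d0 : 0 < l - ga j by rewrite subr_gt0.
  (* Dividing by [l - ga j] exhibits [a j] in the cone of the other generators. *)
  case: irr; rewrite -[vec (a j)]scale1r -(mulVf (lt0r_neq0 d0)) -scalerA.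
  apply: cone_onZ; first by rewrite invr_ge0 ltW.
  rewrite scalerBl -eq_l addrAC subrr add0r.
  exists ga; split=> //; apply: eq_bigl => i.
  by rewrite in_setD1 andbC.
have nz i : exists k, a i k != 0%N.
  apply: contrapT => z; have := minimally_generating_neq0 (i := i) min_a; apply.
  apply/mnmP => k; rewrite mnm0E; apply/eqP/negPn/negP => nzk.
  by apply: z; exists k.
have ga_eq0 i : (i \in J) && (i != j) -> ga i = 0.
  move=> Pi; have [k nzk] := nz i.
  have term0 c i' : 0 <= c -> 0 <= (c *: vec (a i')) 0 k by move=> c0; rewrite !mxE mulr_ge0.
  have : (\sum_(i | (i \in J) && (i != j)) ga i *: vec (a i)) 0 k = 0.
    apply/eqP; rewrite eq_le; apply/andP; split; last first.
      by rewrite summxE sumr_ge0 // => i' _; apply: term0.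
    have -> : \sum_(i | (i \in J) && (i != j)) ga i *: vec (a i) =
        - ((ga j - l) *: vec (a j)).
      by rewrite scalerBl opprB -eq_l addrAC subrr add0r.
    by rewrite mxE oppr_le0; apply: term0; rewrite subr_ge0.
  rewrite summxE => /psumr_eq0P/(_ i Pi) => eq0.
  have /eqP : (ga i *: vec (a i)) 0 k = 0 by apply: eq0 => i' _; apply: term0.
  by rewrite !mxE mulf_eq0 pnatr_eq0 (negPf nzk) orbF => /eqP.
have onray c : (forall i, 0 <= c i) -> (forall i, c i <= ga i) ->
    in_ray (vec (a j)) (\sum_(i in J) c i *: vec (a i)).
  move=> c0 le_c; exists (c j) => //; rewrite (bigD1 j) //= big1 ?addr0 // => i Pi.
  have -> : c i = 0 by apply/eqP; rewrite eq_le c0 andbT -(ga_eq0 i Pi).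
  by rewrite scale0r.
by split; apply: onray => // i; rewrite ?lerDl ?lerDr.
Qed.

(** The ray contains [a j], so it has a nonzero semigroup element [g] of least total degree. Vectors
    on a ray are proportional, so [g] is also smallest in each coordinate. *)
Lemma extremal_ray_on (j : 'I_N) : a j <> 0%MM ->
    spans_cone_extremal_ray a (vec (a j)) ->
  exists2 g, extremal_ray_of a R g & (vec (a j) <= vec g)%MS.
Proof.
move=> nz ext_j; pose onray h := [/\ sgspan a h, h <> 0%MM & in_ray (vec (a j)) (vec h)].
have span_j : sgspan a (a j).
  by apply/sgspanP; exists U_(j)%MM; rewrite mondegU.
have ex : exists n, `[< exists2 h, onray h & mdeg h = n >].
  exists (mdeg (a j)); apply/asboolP; exists (a j) => //; split=> //.
  by exists 1; rewrite ?ler01 ?scale1r.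
case: (ex_minnP ex) => n /asboolP[g [ag ng ray_g] deg_g] min_g.
exists g.
  exists (vec (a j)) => //; split=> // h ah nh ray_h k.
  have : (mdeg g <= mdeg h)%N.
    by rewrite deg_g; apply: min_g; apply/asboolP; exists h.
  case: ray_g ray_h => l l0 /rowP vg [l' l0' /rowP vh].
  have vgE i : (g i)%:R = l * (a j i)%:R by have := vg i; rewrite !mxE.
  have vhE i : (h i)%:R = l' * (a j i)%:R by have := vh i; rewrite !mxE.
  rewrite -(ler_nat R) !mdegE !natr_sum.
  under eq_bigr => i _ do rewrite vgE.
  under [leRHS]eq_bigr => i _ do rewrite vhE.
  rewrite -!mulr_sumr -natr_sum -mdegE ler_pM2r => [le_l|].
    by rewrite -(ler_nat R) vgE vhE ler_wpM2r.
  by rewrite ltr0n lt0n mdeg_eq0; apply/eqP.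
case: ray_g => l _ vg; have nl : l != 0.
  by apply: contra_notN ng => /eqP l0; apply: vec_inj; rewrite vec0 vg l0 scale0r.
by rewrite vg; apply/submxP; exists (l^-1)%:M; rewrite mul_scalar_mx scalerK.
Qed.

End ExtremalRays.

(** Only the linear span is kept from the cone, since directness will follow from linear
    independence. *)
Lemma ray_span (R : realType) (m r n : nat) (a : 'I_(r + n) -> 'X_{1..m}) :
    minimally_generating a ->
    (forall g, extremal_ray_of a R g <-> exists i : 'I_r, g = a (lshift n i)) ->
  forall g, sgspan a g ->
    (vec_of R g <= \matrix_(i < r) vec_of R (a (lshift n i)))%MS.
Proof.
move=> min_a rays; set M := \matrix_(i < r) _.
have [i|J [genJ irr]] := @irredundant_cone R m _ a [set: _].
  apply: cone_onT; exists (fun j => (j == i)%:R); split=> [j|]; first exact: ler0n.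
  rewrite (bigD1 i) //= eqxx scale1r big1 ?addr0 // => j /negPf->.
  by rewrite scale0r.
have subJ j : j \in J -> (vec_of R (a j) <= M)%MS.
  move=> jJ; have ext_j := extremal_of_irredundant min_a genJ jJ (irr j jJ).
  have [g /rays[i ->] sub_g] := extremal_ray_on (@minimally_generating_neq0 _ _ _ j min_a) ext_j.
  apply: submx_trans sub_g _.
  by have := row_sub i M; rewrite rowK.
have sub i : (vec_of R (a i) <= M)%MS.
  have [al [_ ->]] := genJ i; apply: summx_sub => j jJ.
  exact/scalemx_sub/subJ.
move=> g [c ->]; elim/big_rec: _ => [|i h _ sub_h]; first by rewrite vec0 sub0mx.
by rewrite vecD vecMn addmx_sub // scalemx_sub.
Qed.

(** Independence is given over the rationals while cone coefficients are real. The matrix of rays is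
    the image of a rational one, and row freeness is invariant under field extension. *)
Lemma row_free_rays (R : realType) (m r1 r2 : nat)
    (A : 'I_r1 -> 'X_{1..m}) (B : 'I_r2 -> 'X_{1..m}) :
    free ([seq vec_of rat (A i) | i : 'I_r1] ++ [seq vec_of rat (B j) | j : 'I_r2]) ->
  row_free (col_mx (\matrix_(i < r1) vec_of R (A i)) (\matrix_(j < r2) vec_of R (B j))).
Proof.
have sz : size ([seq vec_of rat (A i) | i : 'I_r1] ++
    [seq vec_of rat (B j) | j : 'I_r2]) == (r1 + r2)%N.
  by rewrite size_cat !size_image !card_ord.
rewrite -[X in free X]/(tval (Tuple sz)) => /freeP freeX.
pose M := col_mx (\matrix_(i < r1) vec_of rat (A i)) (\matrix_(j < r2) vec_of rat (B j)).
have -> : col_mx (\matrix_(i < r1) vec_of R (A i)) (\matrix_(j < r2) vec_of R (B j)) =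
    map_mx ratr M.
  by rewrite map_col_mx; congr col_mx; apply/matrixP => i k; rewrite !mxE ratr_nat.
rewrite row_free_map; apply: inj_row_free => v v0; apply/rowP => i; rewrite mxE.
apply: (freeX (fun i => v 0 i)); rewrite -[RHS]v0 mulmx_sum_row.
have nthE r (f : 'I_r -> 'rV[rat]_m) (j : 'I_r) : [seq f i | i : 'I_r]`_j = f j.
  by rewrite /image_mem (nth_map j) ?size_enum_ord // nth_ord_enum.
apply: eq_bigr => {}i _; congr (_ *: _); rewrite /= nth_cat size_image card_ord.
rewrite -[in row i _](splitK i); case: (splitP i) => j -> /=.
  by rewrite nthE; apply/rowP => k; rewrite [in RHS]mxE col_mxEu !mxE.
rewrite addKn nthE.
by apply/rowP => k; rewrite [in RHS]mxE col_mxEd !mxE.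
Qed.

(** Expanding all four elements in the rays, the difference of the two sums is a linear relation
    among independent vectors, so the [b]-coefficients [w1] and [w2] agree. *)
Lemma rays_direct (R : realType) (m r1 r2 n1 n2 : nat)
    (a : 'I_(r1 + n1) -> 'X_{1..m}) (b : 'I_(r2 + n2) -> 'X_{1..m}) :
    minimally_generating a -> minimally_generating b ->
    (forall g, extremal_ray_of a R g <-> exists i : 'I_r1, g = a (lshift n1 i)) ->
    (forall g, extremal_ray_of b R g <-> exists j : 'I_r2, g = b (lshift n2 j)) ->
    free ([seq vec_of rat (a (lshift n1 i)) | i : 'I_r1] ++
          [seq vec_of rat (b (lshift n2 j)) | j : 'I_r2]) ->
  sgspan_direct a b.
Proof.
move=> min_a min_b rays_a rays_b /(row_free_rays R) freeM al1 al2 be1 be2.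
move=> /(ray_span min_a rays_a) + /(ray_span min_a rays_a) +.
move=> /[swap] /submxP[u2 u2E] /submxP[u1 u1E].
move=> /(ray_span min_b rays_b)/submxP[w1 w1E] /(ray_span min_b rays_b)/submxP[w2 w2E].
move/(congr1 (vec_of R)); rewrite !vecD u1E u2E w1E w2E => eq12.
apply: (@vec_inj R); rewrite w1E w2E.
have : row_mx (u1 - u2) (w1 - w2) *m col_mx
    (\matrix_(i < r1) vec_of R (a (lshift n1 i)))
    (\matrix_(j < r2) vec_of R (b (lshift n2 j))) = 0.
  rewrite mul_row_col !mulmxBl addrACA -opprD [X in X - _]addrC eq12 [X in _ - X]addrC.
  exact: subrr.
move=> /eqP; rewrite mulmx_free_eq0 // => /eqP; rewrite -row_mx0.
by move=> /eq_row_mx[_ /eqP]; rewrite subr_eq0 => /eqP->.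
Qed.

(** * The join *)

Lemma msupp_toric_map (K : fieldType) m N (c : 'I_N -> 'X_{1..m}) (p : {mpoly K[N]}) g :
  g \in msupp (toric_map c p) -> exists2 e, e \in msupp p & g = mondeg c e.
Proof.
rewrite {1}[p]mpolyE raddf_sum big_seq => /msupp_sum_le/flatten_mapP[e].
rewrite mem_filter => /andP[pe _] /=.
rewrite /toric_map comp_mpolyZ -/(toric_map c _) => /msuppZ_le.
by rewrite toric_mapX msuppX inE => /eqP->; exists e.
Qed.

Lemma mpolyX_inj (K : fieldType) n : injective (fun e : 'X_{1..n} => 'X_[e] : {mpoly K[n]}).
Proof. by move=> e1 e2 /(congr1 (@msupp _ _)); rewrite !msuppX => -[]. Qed.

Lemma extended_ideal_sum (A B : comNzRingType) (phi : A -> B) (I : A -> Prop)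
    (T : finType) (c : T -> B) (s : T -> A) :
  (forall t, I (s t)) -> extended_ideal phi I (\sum_t c t * phi (s t)).
Proof.
move=> Is; exists #|T|, (fun i => c (enum_val i)), (fun i => s (enum_val i)).
by split=> // ; rewrite -(big_enum_val (fun t => c t * phi (s t))).
Qed.

Lemma dcoef_graded (K : fieldType) m N (c : 'I_N -> 'X_{1..m}) (H : free_complex K m N)
    (X Y : {p : nat & gbasis H p}) e :
  graded_maps c H -> e \in msupp (dcoef X Y) ->
  (mondeg c e + gdeg H (tagged Y))%MM = gdeg H (tagged X).
Proof.
case=> gr _; case: X Y => p i [q j]; rewrite /dcoef.
have [eq_p|neq] := eqVneq p q.+1; last by rewrite untag_dflt ?msupp0.
case: _ / (esym eq_p) i => i; rewrite untag_Tagged; exact: gr.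
Qed.

Lemma daug_graded (K : fieldType) m N (c : 'I_N -> 'X_{1..m}) (H : free_complex K m N)
    (X : {p : nat & gbasis H p}) g :
  graded_maps c H -> g \in msupp (daug X) -> g = gdeg H (tagged X).
Proof.
case=> _ gr; case: X => p i; rewrite /daug.
have [eq_p|neq] := eqVneq p 0%N; last by rewrite untag_dflt ?msupp0.
case: _ / (esym eq_p) i => i; rewrite untag_Tagged; exact: gr.
Qed.

Lemma dcoef_minimal (K : fieldType) m N (H : free_complex K m N)
    (X Y : {p : nat & gbasis H p}) :
  minimal_maps H -> (dcoef X Y)@_0%MM = 0.
Proof.
move=> minH; case: X Y => p i [q j]; rewrite /dcoef.
have [eq_p|neq] := eqVneq p q.+1; last by rewrite untag_dflt ?mcoeff0.
by case: _ / (esym eq_p) i => i; rewrite untag_Tagged -gdiff_basis.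
Qed.

Section Join.
Variables (K : fieldType) (m N1 N2 : nat).
Variables (a : 'I_N1 -> 'X_{1..m}) (b : 'I_N2 -> 'X_{1..m}).

(** [incl1] is itself the toric map of the exponents [U_(lshift N2 i)], so the identity of degrees
    is [toric_map_incl1] read on a monomial. *)
Lemma mondeg_lshift e :
  mondeg (join_gens a b) (mondeg (fun i => U_(lshift N2 i))%MM e) = mondeg a e.
Proof.
apply: (@mpolyX_inj K); rewrite -[RHS]toric_mapX -(toric_map_incl1 a b).
by rewrite -toric_mapX; congr toric_map; rewrite -toric_mapX.
Qed.

Lemma mondeg_rshift e :
  mondeg (join_gens a b) (mondeg (fun i => U_(rshift N1 i))%MM e) = mondeg b e.
Proof.
apply: (@mpolyX_inj K); rewrite -[RHS]toric_mapX -(toric_map_incl2 a b).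
by rewrite -toric_mapX; congr toric_map; rewrite -toric_mapX.
Qed.

Lemma msupp_incl1 (p : {mpoly K[N1]}) e : e \in msupp (incl1 N2 p) ->
  exists2 e1, e1 \in msupp p & mondeg (join_gens a b) e = mondeg a e1.
Proof. by case/msupp_toric_map => e1 ? ->; exists e1 => //; apply: mondeg_lshift. Qed.

Lemma msupp_incl2 (p : {mpoly K[N2]}) e : e \in msupp (incl2 N1 p) ->
  exists2 e2, e2 \in msupp p & mondeg (join_gens a b) e = mondeg b e2.
Proof. by case/msupp_toric_map => e2 ? ->; exists e2 => //; apply: mondeg_rshift. Qed.

Lemma sgspan_join g : sgspan (join_gens a b) g <->
  exists al be, [/\ sgspan a al, sgspan b be & g = (al + be)%MM].
Proof.
split=> [/sgspanP[e ->]|[al [be [/sgspanP[e1 ->] /sgspanP[e2 ->] ->]]]].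
  exists (mondeg a [multinom e (lshift N2 i) | i < N1]).
  exists (mondeg b [multinom e (rshift N1 i) | i < N2]).
  split; try by apply/sgspanP; eexists.
  rewrite {1}/mondeg big_split_ord; congr (_ + _)%MM; apply: eq_bigr => i _;
    rewrite mnmE /join_gens.
    by rewrite -[lshift _ _]/(unsplit (inl _)) unsplitK.
  by rewrite -[rshift _ _]/(unsplit (inr _)) unsplitK.
by apply: sgspanD; apply/sgspanP; eexists; rewrite -?mondeg_lshift -?mondeg_rshift.
Qed.

Lemma mcoeff0_incl1 (p : {mpoly K[N1]}) : (incl1 N2 p)@_0%MM = p@_0%MM.
Proof.
apply: (mpoly_rmorph_ext (f := mcoeff 0%MM \o incl1 N2) (g := mcoeff 0%MM)) => [c|i] /=.
  by rewrite incl1C !mcoeffC !eqxx.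
by rewrite incl1U !mcoeffX !mnm1_eq0.
Qed.

Lemma mcoeff0_incl2 (p : {mpoly K[N2]}) : (incl2 N1 p)@_0%MM = p@_0%MM.
Proof.
apply: (mpoly_rmorph_ext (f := mcoeff 0%MM \o incl2 N1) (g := mcoeff 0%MM)) => [c|i] /=.
  by rewrite incl2C !mcoeffC !eqxx.
by rewrite incl2U !mcoeffX !mnm1_eq0.
Qed.

Hypothesis dir : sgspan_direct a b.

(** For [f] in the kernel, directness puts every slice in the ideal of [a]. Subtracting the slices
    times lifts of t^del leaves a polynomial whose x-coefficients all lie in the ideal of [b]. *)
Lemma defining_ideal_join (f : {mpoly K[N1 + N2]}) :
  defining_ideal (join_gens a b) f <->
  ideal_sum (extended_ideal (incl1 N2) (defining_ideal a))
            (extended_ideal (incl2 N1) (defining_ideal b)) f.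
Proof.
have sg0 N (c : 'I_N -> 'X_{1..m}) : in_sgring (sgspan c) (1 : {mpoly K[m]}).
  move=> g; rewrite msupp1 inE => /eqP->; apply/sgspanP; exists 0%MM.
  apply/mnmP => k; rewrite mnm_sumE big1 ?mnm0E // => i _.
  by rewrite mulmnE mnm0E muln0.
split=> [f0|[u [v [[k [c [s [Is ->]]]] [k' [c' [s' [Is' ->]]]] ->]]]]; last first.
  rewrite /defining_ideal rmorphD !rmorph_sum /= !big1 ?addr0 // => i _ /=.
    by rewrite rmorphM /= toric_map_incl2 Is' mulr0.
  by rewrite rmorphM /= toric_map_incl1 Is mulr0.
(* Both rings are treated as free modules of rank one, augmented by sending the generator to 1. *)
pose one (_ : 'I_1) : {mpoly K[m]} := 1.
have lift gam : sgspan b gam -> exists u, augment b one u = 'X_[gam].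
  case/sgspanP => e ->; exists (fun=> 'X_[e]).
  by rewrite /augment big_ord1 mulr1 toric_mapX.
have [B [U UP]] := tslice_lift (fun _ : 'I_1 => fun=> f) (fun=> @sg0 _ b) lift.
pose s del := tslice b one del (fun=> f).
have sI del : defining_ideal a (s del).
  have := augment_join_eq0 (z := fun _ : 'I_1 => fun _ : 'I_1 => f) dir
    (fun=> @sg0 _ a) (fun=> @sg0 _ b).
  rewrite !big_ord1 f0 mul0r => /(_ erefl del).
  by rewrite /augment big_ord1 mulr1.
exists (\sum_(del : 'X_{1..m < B}) incl2 N1 (U del ord0) * incl1 N2 (s del)).
pose g := f - \sum_(del : 'X_{1..m < B}) incl1 N2 (s del) * incl2 N1 (U del ord0).
exists g; split.
- exact: extended_ideal_sum.
- rewrite (xcoef_expand (leqnn (msize (poly_in_x g)))).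
  apply: extended_ideal_sum => e; rewrite /defining_ideal.
  have := tslice_eq0 (UP ord0) e.
  by rewrite /augment big_ord1 mulr1.
- rewrite addrC /g; under [X in _ + X]eq_bigr => del _ do rewrite mulrC.
  by rewrite subrK.
Qed.

(** * Grading, minimality and exactness of the tensor complex *)

Variables (F : free_complex K m N1) (G : free_complex K m N2).

Lemma tensor_graded : graded_maps a F -> graded_maps b G ->
  graded_maps (join_gens a b) (tensor_complex F G).
Proof.
move=> grF grG; split=> [n x y e|x g].
  have suppMn (p : {mpoly K[N1 + N2]}) (c : bool) : e \in msupp (p *+ c) ->
      e \in msupp p /\ c by case: c; rewrite ?mulr0n ?msupp0.
  rewrite /= -[tdeg x]/(gdeg F (tagged (tfst x)) + gdeg G (tagged (tsnd x)))%MM.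
  rewrite -[tdeg y]/(gdeg F (tagged (tfst y)) + gdeg G (tagged (tsnd y)))%MM.
  move/msuppD_le; rewrite mem_cat => /orP[] /suppMn[].
    move=> /msupp_incl1[e1 e1_in ->] /eqP->; rewrite addmA.
    by rewrite (dcoef_graded grF e1_in).
  rewrite -signr_odd mulr_sign.
  have -> : e \in msupp (if odd (tag x) then - incl2 N1 (dcoef (tsnd x) (tsnd y))
                         else incl2 N1 (dcoef (tsnd x) (tsnd y))) =
            (e \in msupp (incl2 N1 (dcoef (tsnd x) (tsnd y)))).
    by case: ifP => // _; rewrite (perm_mem (msuppN _)).
  move=> /msupp_incl2[e2 e2_in ->] /eqP->.
  rewrite addmA [(mondeg b _ + _)%MM]addmC -addmA.
  by rewrite (dcoef_graded grG e2_in).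
case/msuppM_le/allpairsP => -[g1 g2] /= [g1_in g2_in ->].
by rewrite (daug_graded grF g1_in) (daug_graded grG g2_in).
Qed.

(** The constant term is a ring morphism compatible with both inclusions, so it is enough that each
    coefficient [dcoef] has none. *)
Lemma tensor_minimal :
  minimal_maps F -> minimal_maps G -> minimal_maps (tensor_complex F G).
Proof.
move=> minF minG n u y; rewrite ffunE raddf_sum big1 // => x _.
rewrite /= rmorphM /= raddfD !raddfMn /= rmorphM /= mcoeff0_incl1 mcoeff0_incl2.
by rewrite !dcoef_minimal // mulr0 !mul0rn addr0 mulr0.
Qed.

Hypotheses (resF : resolves a F) (resG : resolves b G).

Lemma tensor_resolves : resolves (join_gens a b) (tensor_complex F G).
Proof.
split.
- move=> x g /msuppM_le/allpairsP[[al be] /= [al_in be_in ->]].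
  apply/sgspan_join; exists al, be; split=> //.
    move: al_in; rewrite /daug; have /eqP := tag_tbasis x.
    rewrite addn_eq0 => /andP[/eqP p0 _]; rewrite untagE; exact: resolves_gaug.
  move: be_in; rewrite /daug; have /eqP := tag_tbasis x.
  rewrite addn_eq0 => /andP[_ /eqP q0]; rewrite untagE; exact: resolves_gaug.
- move=> f joinf.
  have /choice[u uP] : forall gam, exists u : gmod (tensor_complex F G) 0,
      sgspan (join_gens a b) gam -> gaugmentation (join_gens a b) u = 'X_[gam].
    move=> gam; have [/sgspan_join[al [be [aal bbe ->]]]|] :=
      EM (sgspan (join_gens a b) gam); last by exists 0.
    have [v vE] := resolves_lift resF aal; have [w wE] := resolves_lift resG bbe.
    (* A lift of t^al to F_0 times a lift of t^be to G_0 lifts t^(al + be). *)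
    pose z (X : {p : nat & gbasis F p}) (Y : {q : nat & gbasis G q}) :=
      incl1 N2 (untag 0 v X) * incl2 N1 (untag 0 w Y).
    exists [ffun x : tbasis F G 0 => z (tfst x) (tsnd x)] => _.
    rewrite (@gaugmentation_tensor _ _ _ _ _ _ _ _ z) => [|x]; last by rewrite ffunE.
    rewrite mpolyXD -vE -wE /augment big_distrlr /=.
    apply: eq_bigr => i _; apply: eq_bigr => j _.
    by rewrite rmorphM /= toric_map_incl1 toric_map_incl2 !untag_Tagged mulrACA.
  pose v : gmod (tensor_complex F G) 0 :=
    [ffun x => \sum_(gam <- msupp f) f@_gam *: u gam x].
  have vE x : v x = \sum_(gam <- msupp f) f@_gam *: u gam x by rewrite ffunE.
  exists v; rewrite [RHS]mpolyE [RHS]big_seq /gaugmentation.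
  under [LHS]eq_bigr => x _ do rewrite vE raddf_sum mulr_suml.
  rewrite exchange_big [LHS]big_seq; apply: eq_bigr => gam gam_in.
  rewrite -(uP gam (joinf _ gam_in)) scaler_sumr; apply: eq_bigr => x _.
  by rewrite /= /toric_map comp_mpolyZ scalerAl.
- move=> u; split=> [u0|[v ->]].
    have [|w wP] := tensor_exact0 (z := cochain_of u) resF resG dir.
      by rewrite -(gaugmentation_tensor _ (cochain_ofE u)).
    exists [ffun x : tbasis F G 1 => w (tfst x) (tsnd x)]; apply/ffunP => y.
    rewrite (gdiff_tensor (z := w)) => [|x]; last by rewrite ffunE.
    by rewrite cochain_ofE wP // tag_tbasis.
  rewrite (gaugmentation_tensor _ (gdiff_tensor (cochain_ofE v))).
  exact: tensor_complex0.
- move=> n u; split=> [u0|[v ->]].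
    have [|w wP] := tensor_exact (n := n) (z := cochain_of u) resF resG.
      move=> X Y XY; have [y <- <-] := tbasis_lift XY.
      by rewrite -(gdiff_tensor (cochain_ofE u)) u0 ffunE.
    exists [ffun x : tbasis F G n.+2 => w (tfst x) (tsnd x)]; apply/ffunP => y.
    rewrite (gdiff_tensor (z := w)) => [|x]; last by rewrite ffunE.
    by rewrite cochain_ofE wP // tag_tbasis.
  apply/ffunP => y; rewrite (gdiff_tensor (gdiff_tensor (cochain_ofE v))) ffunE.
  exact: (tdiffK resF resG).
Qed.

End Join.

Theorem theorem4p2 (R : realType) (K : fieldType) (r1 r2 n1 n2 : nat)
    (a : 'I_(r1 + n1) -> 'X_{1..(r1 + r2)})
    (b : 'I_(r2 + n2) -> 'X_{1..(r1 + r2)})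
    (a_min : minimally_generating a)
    (b_min : minimally_generating b)
    (ab_disjoint : forall i j, a i <> b j)
    (a_rays : forall g, extremal_ray_of a R g <->
                exists i : 'I_r1, g = a (lshift n1 i))
    (b_rays : forall g, extremal_ray_of b R g <->
                exists j : 'I_r2, g = b (lshift n2 j))
    (ab_free : free ([seq vec_of rat (a (lshift n1 i)) | i : 'I_r1] ++
                     [seq vec_of rat (b (lshift n2 j)) | j : 'I_r2])) :
  (forall f : {mpoly K[(r1 + n1) + (r2 + n2)]},
     defining_ideal (join_gens a b) f <->
     ideal_sum
       (extended_ideal (incl1 (r2 + n2)) (defining_ideal a))
       (extended_ideal (incl2 (r1 + n1)) (defining_ideal b)) f) /\
  (forall (F : free_complex K (r1 + r2) (r1 + n1))
          (G : free_complex K (r1 + r2) (r2 + n2)),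
     minimal_graded_free_resolution a F ->
     minimal_graded_free_resolution b G ->
     minimal_graded_free_resolution (join_gens a b) (tensor_complex F G)).
Proof.
have dir := rays_direct a_min b_min a_rays b_rays ab_free.
split=> [f|F G [grF resF minF] [grG resG minG]].
  exact: defining_ideal_join.
split; [exact: tensor_graded|exact: tensor_resolves|exact: tensor_minimal].
Qed.
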